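(* Uniqueness holds for the degrees $d=1$, $d=3$, $d=5$ and $d=9$. Uniqueness fails in the following cases. 1) Suppose $d\ge 2$ is even. Then uniqueness fails for $d$. 2) Suppose $d$ is congruent to $3$ mod $4$. Then uniqueness holds for $d=3$ and fails for every such $d\ge 7$. 3) Suppose $d$ is congruent to $1$ mod $4$. Uniqueness holds for $d=1$; uniqueness (up to equivalence) holds for $d=5$. Uniqueness fails for every $d$ of the form $$d=\frac{(7+4\sqrt{3})^{2k}+(7-4\sqrt{3})^{2k}}{2},$$ where $k$ is a positive integer. 4) Suppose $d>1$ and $d$ is congruent to $1$ mod $6$. Then uniqueness fails for $d$.
   Context: $\mathcal{H}(2)$ denotes the set of polynomials $p\in\mathbf{R}[x,y]$ all of whose coefficients are nonnegative and which satisfy $p(x,y)=1$ whenever $x+y=1$. $\mathcal{H}(2,d)$ is the set of elements of $\mathcal{H}(2)$ of degree $d$. The number of terms of a polynomial is the number of distinct monomials occurring in it with nonzero coefficient. Elements $f,g\in\mathcal{H}(2,d)$ are equivalent if either $f=g$ or $f(x,y)=g(y,x)$. Uniqueness holds for a degree $d$ if the following is true: whenever $f,g\in\mathcal{H}(2,d)$ have the same number of terms and there is no $h\in\mathcal{H}(2,d)$ with fewer terms, then $f$ and $g$ are equivalent. Uniqueness fails for $d$ if it does not hold for $d$. *)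

(* Defs.v *)
From mathcomp Require Import all_boot all_order all_fingroup all_algebra.
From mathcomp Require Import reals.
From mathcomp Require Import mpoly.

Set Implicit Arguments.
Unset Strict Implicit.
Unset Printing Implicit Defensive.

Import Order.TTheory GRing.Theory Num.Theory.
Local Open Scope ring_scope.

(* Polynomials in x = 'X_0 and y = 'X_1, the indices being 0, 1 : 'I_2. *)

Definition in_H2 (R : realType) (p : {mpoly R[2]}) : Prop :=
  (forall m : 'X_{1..2}, 0 <= p@_m) /\
  (forall v : 'I_2 -> R, v 0 + v 1 = 1 -> p.@[v] = 1).

(* [msize p] is the total degree plus one for nonzero [p], and 0 for [p = 0]. *)
Definition in_H2d (R : realType) (d : nat) (p : {mpoly R[2]}) : Prop :=
  in_H2 p /\ msize p = d.+1.

Definition nterms (R : realType) (p : {mpoly R[2]}) : nat := size (msupp p).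

(* [msym (tperm 0 1) g] is g(y, x). *)
Definition equivalent (R : realType) (f g : {mpoly R[2]}) : Prop :=
  f = g \/ f = msym (tperm 0 1) g.

Definition uniqueness (R : realType) (d : nat) : Prop :=
  forall f g : {mpoly R[2]},
    in_H2d d f -> in_H2d d g ->
    nterms f = nterms g ->
    ~ (exists h : {mpoly R[2]}, in_H2d d h /\ (nterms h < nterms f)%N) ->
    equivalent f g.

(* Main.v *)
(* A polynomial p with p = 1 on x + y = 1 is a flow on the lattice: a unit mass
   enters at the monomial 1, the monomial m keeps the mass p@_m and sends the rest q_m
   to both m x and m y, so that p@_m = q_(m/x) + q_(m/y) - q_m.  Give a sign to every
   lattice point of degree < d, the sign of q where q is nonzero.  Counting the sign
   changes along the edges of the triangular grid shows that at least (d - 1) / 2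
   triangles {m/x, m/y, m}, corners excluded, have both predecessors of one sign and m
   of the other.  The zeros of q can be coloured, by rows on one side of a path of
   positive values and by columns on the other side, so that each of these triangles
   forces p@_m > 0.  With the two pure powers at the ends this gives
   2 N >= d + 3 for the number N of terms.

   In case of equality x^d and y^d are the only pure powers, which leaves (d - 1) / 2
   interior monomials whose weighted sum is (x+y)^d - x^d - y^d; for d = 1, 3, 5, 9 an
   exhaustive exact elimination finds only one solution up to symmetry.

   For the failures, with x = u + v and y = - u v, the polynomials u^d + v^d + y^d
   (d odd) attain the bound, and on x + y = 1 the identity u^(2m) + v^(2m) = 1 + y^(2m)
   replaces two of their terms by two others whenever a positive multiple
   of x^a y^s (u^(2m) + v^(2m)) matches two of their coefficients and is
   dominated by the others. *)
Require Import Defs.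
From Stdlib Require Import ZArith.
From mathcomp Require Import all_boot all_order all_fingroup all_algebra.
From mathcomp Require Import reals.
From mathcomp Require Import mpoly zify ssrZ ring lra.

Set Implicit Arguments.
Unset Strict Implicit.
Unset Printing Implicit Defensive.

Import Order.TTheory GRing.Theory Num.Theory.
Local Open Scope ring_scope.

(** * Sign changes in a triangular grid *)

Section SignCounting.
Variables (D : nat) (s : nat -> nat -> bool).
Local Open Scope nat_scope.

(* [s n b] is the sign at x^(n-b) y^b.  [mono n b] says that (n, b) is opposite in
   sign to both (n-1, b) and (n-1, b-1), ignoring those of the three points that lie
   outside the grid 0 <= b <= n <= D; the three corners are left out. *)
Definition mono (n b : nat) : bool :=
  if n is m.+1 then
    if n <= D then
      if b == 0 then s m 0 != s n 0
      else if b == n then s m m != s n n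
      else [&& b < n, s m b == s m b.-1 & s m b != s n b]
    else [&& n == D.+1, 0 < b < n & s D b == s D b.-1]
  else false.

Definition outer (n b : nat) : bool := [|| b == 0, b == n | n == D.+1].

Arguments mono : simpl never.
Arguments outer : simpl never.

Definition level_changes (n : nat) : nat := \sum_(b < n) (s n b != s n b.+1).

(* Two adjacent equal signs x, x' give 2 [x = x' != y] = [x != y] + [x' != y] - [x != x'],
   so the triangles between two levels are counted by the bichromatic edges. *)
Lemma mono_step n : n < D ->
  level_changes n.+1 + \sum_(b < n.+2) (mono n.+1 b && outer n.+1 b)
  <= level_changes n + 2 * \sum_(b < n.+2) mono n.+1 b.
Proof.
move=> ltnD.
have E0 : mono n.+1 0 = (s n 0 != s n.+1 0) by rewrite /mono ltnD.
have En : mono n.+1 n.+1 = (s n n != s n.+1 n.+1) by rewrite /mono ltnD eqxx.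
have Ei (b : 'I_n) : mono n.+1 b.+1 =
    (s n b.+1 == s n b) && (s n b.+1 != s n.+1 b.+1).
  rewrite /mono ltnD /= eqSS; have := ltn_ord b; rewrite ltnS.
  by case: ltngtP.
have Oi (b : 'I_n) : outer n.+1 b.+1 = false.
  by rewrite /outer !eqSS (ltn_eqF ltnD) (ltn_eqF (ltn_ord b)).
have -> : \sum_(b < n.+2) (mono n.+1 b && outer n.+1 b)
    = (s n 0 != s n.+1 0) + (s n n != s n.+1 n.+1).
  rewrite big_ord_recl big_ord_recr /= E0 En big1 => [|i _].
    by rewrite /outer !eqxx !orbT !andbT add0n.
  by rewrite Oi andbF.
have -> : \sum_(b < n.+2) mono n.+1 b = (s n 0 != s n.+1 0)
    + \sum_(b < n) ((s n b.+1 == s n b) && (s n b.+1 != s n.+1 b.+1))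
    + (s n n != s n.+1 n.+1).
  rewrite big_ord_recl big_ord_recr /= E0 En addnA; congr (_ + _ + _).
  by apply: eq_bigr => i _; rewrite Ei.
set x0 := nat_of_bool (s n 0 != _); set xn := nat_of_bool (s n n != _).
have T : 2 * \sum_(b < n) ((s n b.+1 == s n b) && (s n b.+1 != s n.+1 b.+1))
    + level_changes n
    = \sum_(b < n) (s n b != s n.+1 b.+1) + \sum_(b < n) (s n b.+1 != s n.+1 b.+1).
  rewrite big_distrr -!big_split /=; apply: eq_bigr => i _.
  by case: (s n i); case: (s n i.+1); case: (s n.+1 i.+1).
(* An edge of the upper level joins the two successors of the point (n, i), so a sign change along
   it forces one along an edge to that point. *)
have U : level_changes n.+1 <= \sum_(b < n.+1) (s n b != s n.+1 b)
    + \sum_(b < n.+1) (s n b != s n.+1 b.+1).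
  rewrite -big_split /=; apply: leq_sum => i _.
  by case: (s n i); case: (s n.+1 i); case: (s n.+1 i.+1).
have U0 : \sum_(b < n.+1) (s n b != s n.+1 b)
    = x0 + \sum_(b < n) (s n b.+1 != s n.+1 b.+1) by rewrite big_ord_recl.
have Un : \sum_(b < n.+1) (s n b != s n.+1 b.+1)
    = \sum_(b < n) (s n b != s n.+1 b.+1) + xn by rewrite big_ord_recr.
move: T U; rewrite U0 Un; lia.
Qed.

Lemma mono_levels n : n <= D ->
  level_changes n + \sum_(m < n.+1) \sum_(b < m.+1) (mono m b && outer m b)
  <= 2 * \sum_(m < n.+1) \sum_(b < m.+1) mono m b.
Proof.
elim: n => [|n IHn] ltnD.
  by rewrite /level_changes big_ord0 !big_ord_recl !big_ord0.
have := IHn (ltnW ltnD); have := mono_step ltnD.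
rewrite (big_ord_recr n.+1 (fun m : 'I_n.+2 => \sum_(b < m.+1) (mono m b && outer m b))).
rewrite (big_ord_recr n.+1 (fun m : 'I_n.+2 => \sum_(b < m.+1) mono m b)) /=.
lia.
Qed.

(** Telescoping leaves the sign changes along level [D]. The other edges of that level join equal
    signs and are exactly the triangles counted at level [D.+1], so both together make [D]. *)
Lemma mono_count :
  D + \sum_(m < D.+2) \sum_(b < m.+1) (mono m b && outer m b)
  <= 2 * \sum_(m < D.+2) \sum_(b < m.+1) mono m b.
Proof.
have := mono_levels (leqnn D).
rewrite (big_ord_recr D.+1 (fun m : 'I_D.+2 => \sum_(b < m.+1) (mono m b && outer m b))).
rewrite (big_ord_recr D.+1 (fun m : 'I_D.+2 => \sum_(b < m.+1) mono m b)) /=.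
set o := \sum_(m < D.+1) _; set w := \sum_(m < D.+1) _.
have M (b : nat) : mono D.+1 b && outer D.+1 b = mono D.+1 b.
  by rewrite /outer eqxx !orbT andbT.
rewrite (eq_bigr (fun b : 'I_D.+2 => nat_of_bool (mono D.+1 b))); last first.
  by move=> b _; rewrite M.
suff : level_changes D + \sum_(b < D.+2) mono D.+1 b = D.
  set z := \sum_(b < D.+2) mono D.+1 b.
  move: (level_changes D) o w z => c o w z; lia.
have M0 : mono D.+1 0 = false by rewrite /mono ltnn andbF.
have Mn : mono D.+1 D.+1 = false by rewrite /mono ltnn ltnn !andbF.
have Mi (b : 'I_D) : mono D.+1 b.+1 = (s D b.+1 == s D b).
  by rewrite /mono ltnn eqxx /= ltnS ltn_ord.
rewrite big_ord_recl big_ord_recr /= M0 Mn add0n addn0 /level_changes -big_split.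
rewrite /= -[RHS](card_ord D) -sum1_card; apply: eq_bigr => b _.
by rewrite Mi eq_sym; case: eqP.
Qed.

End SignCounting.

(** * Flows on the lattice *)

Lemma mono_le D s n b : mono D s n b -> (b <= n)%N.
Proof.
case: n => // n; rewrite /mono.
case: (leqP n.+1 D) => _; last by case/and3P => _ /andP[_ /ltnW].
case: eqP => [-> //|_]; case: eqP => [-> //|_].
by case/and3P => /ltnW.
Qed.

Lemma card_pairs (p : nat -> nat -> bool) N : (forall n b, p n b -> (b <= n)%N) ->
  #|[set x : 'I_N * 'I_N | p x.1 x.2]| = (\sum_(m < N) \sum_(b < m.+1) p m b)%N.
Proof.
move=> le_p; rewrite -sum1dep_card big_mkcond.
rewrite (eq_bigr (fun x : 'I_N * 'I_N => nat_of_bool (p x.1 x.2))); last first.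
  by move=> x _; case: (p _ _).
rewrite -(pair_bigA _ (fun m b : 'I_N => nat_of_bool (p m b))) /=.
apply: eq_bigr => m _; rewrite [RHS](big_ord_widen N (fun b => nat_of_bool (p m b))) //.
rewrite [RHS]big_mkcond; apply: eq_bigr => b _ /=; rewrite ltnS.
by case: leqP => // ltmb; case E: (p m b) => //; have := le_p _ _ E; rewrite leqNgt ltmb.
Qed.

Section Nonincreasing.
Variables (R : realFieldType) (f : nat -> R) (N D : nat).
Hypothesis f_noninc : forall n, (N <= n)%N -> f n.+1 <= f n.
Hypothesis f_end : forall n, (D < n)%N -> f n = 0.

Lemma noninc_leq m n : (N <= m)%N -> (m <= n)%N -> f n <= f m.
Proof.
move=> leNm; elim: n => [|n IHn]; first by rewrite leqn0 => /eqP->.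
rewrite leq_eqVlt => /predU1P[-> //|]; rewrite ltnS => lemn.
exact: le_trans (f_noninc (leq_trans leNm lemn)) (IHn lemn).
Qed.

Lemma noninc_ge0 n : (N <= n)%N -> 0 <= f n.
Proof.
by move=> leNn; rewrite -(f_end (ltn_addl n (ltnSn D))); apply: noninc_leq => //; exact: leq_addr.
Qed.

Lemma noninc_last : 0 < f N ->
  exists2 A, (N <= A <= D)%N & 0 < f A /\ forall n, (A < n)%N -> f n = 0.
Proof.
move=> fN.
have ex0 : exists n, (N <= n)%N && (f n == 0).
  by exists (N + D.+1)%N; rewrite leq_addr f_end ?eqxx // addnS ltnS leq_addl.
case: (ex_minnP ex0) => A /andP[leNA /eqP fA0] minA.
have ltNA : (N < A)%N.
  by rewrite ltn_neqAle leNA andbT; apply: contraTneq fN => ->; rewrite fA0 ltxx.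
case: A fA0 minA {leNA} ltNA => // A fA0 minA; rewrite ltnS => leNA.
have fA : 0 < f A.
  rewrite lt0r noninc_ge0 // andbT; apply/negP => fA'.
  by have := minA A; rewrite leNA fA' ltnn => /(_ isT).
exists A.
  by rewrite leNA leqNgt; apply: contraTN fA => /f_end ->; rewrite ltxx.
split=> // n ltAn; apply/eqP; rewrite eq_le noninc_ge0 ?(leq_trans leNA) 1?ltnW // andbT.
by rewrite -fA0; apply: noninc_leq => //; exact: leq_trans (leqnSn A).
Qed.

End Nonincreasing.

Lemma cardsU2_new (T : finType) (a b : T) (S : {set T}) :
  a != b -> a \notin S -> b \notin S -> #|a |: (b |: S)| = (#|S| + 2)%N.
Proof.
by move=> neab aS bS; rewrite !cardsU1 bS in_setU1 (negbTE neab) (negbTE aS) addn2.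
Qed.

Section Flow.
(** For a polynomial of degree [D.+1], [q n b] is the mass passed on at x^(n-b) y^b and [P n b] the
    mass kept there. *)
Variables (R : realFieldType) (D : nat) (q P : nat -> nat -> R) (h : nat -> nat).
Hypothesis P_ge0 : forall n b, 0 <= P n b.
Hypothesis q_out : forall n b, (n < b)%N -> q n b = 0.
Hypothesis q_top : forall n b, (D < n)%N -> q n b = 0.
Hypothesis q_rec0 : forall n, q n.+1 0%N = q n 0%N - P n.+1 0%N.
Hypothesis q_recS : forall n b, q n.+1 b.+1 = q n b.+1 + q n b - P n.+1 b.+1.
Hypothesis h_gt0 : forall n, (n <= D)%N -> 0 < q n (h n).
Hypothesis h_step : forall n, (n < D)%N -> (h n <= h n.+1 <= (h n).+1)%N.
Hypothesis h0 : h 0 = 0%N.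

(* [h] is a path of positive values.  Zeros below it are coloured by rows, with
   starting colour [e], and zeros above it by columns: then no triangle whose values
   all vanish is counted by [mono]. *)
Definition label (e : bool) (n b : nat) : bool :=
  if q n b == 0 then if (b < h n)%N then e (+) odd b else ~~ odd (n - b)
  else 0 < q n b.

Lemma label_ge0 e n b : label e n b -> 0 <= q n b.
Proof. by rewrite /label; case: eqP => [-> //|_ /ltW]. Qed.

Lemma label_le0 e n b : label e n b = false -> q n b <= 0.
Proof. by rewrite /label; case: eqP => [-> //|_ /negbT]; rewrite -leNgt. Qed.

Lemma label_gt0 e n b : 0 < q n b -> label e n b.
Proof. by move=> q_gt0; rewrite /label gt_eqF. Qed.

Lemma label_right e n b : q n b = 0 -> (b < h n)%N -> label e n b = e (+) odd b.
Proof. by rewrite /label => -> ->; rewrite eqxx. Qed.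

Lemma label_left e n b : q n b = 0 -> (h n < b)%N -> label e n b = ~~ odd (n - b).
Proof. by rewrite /label => -> /ltnW; rewrite eqxx leqNgt => /negbTE ->. Qed.

Lemma q0_side n b : (n <= D)%N -> q n b = 0 -> (b < h n)%N || (h n < b)%N.
Proof.
move=> lenD q0; rewrite -neq_ltn; apply/eqP => bh.
by have := h_gt0 lenD; rewrite -bh q0 ltxx.
Qed.

Lemma h_le n : (n <= D)%N -> (h n <= n)%N.
Proof.
by move=> lenD; rewrite leqNgt; apply/negP => /q_out q0; have := h_gt0 lenD; rewrite q0 ltxx.
Qed.

Lemma h_mono m n : (m <= n)%N -> (n <= D)%N -> (h m <= h n)%N.
Proof.
elim: n => [|n IHn]; first by rewrite leqn0 => /eqP->.
rewrite leq_eqVlt => /predU1P[-> //|]; rewrite ltnS => lemn ltnD.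
by have /andP[] := h_step ltnD; have := IHn lemn (ltnW ltnD); lia.
Qed.

(** The path moves by at most one per level and never meets a zero, so a zero does not change sides
    between a point and its predecessor. *)
Lemma right_pred n b : (n < D)%N -> q n b = 0 -> (b < h n.+1)%N -> (b < h n)%N.
Proof.
move=> ltnD q0 bh; have /andP[_ hS] := h_step ltnD.
have := q0_side (ltnW ltnD) q0; lia.
Qed.

Lemma left_pred n b : (n < D)%N -> q n b = 0 -> (h n.+1 < b.+1)%N -> (h n < b)%N.
Proof.
move=> ltnD q0 bh; have /andP[hS _] := h_step ltnD.
have := q0_side (ltnW ltnD) q0; lia.
Qed.

Lemma bottom_noninc n : q n.+1 0%N <= q n 0%N.
Proof. by rewrite q_rec0 gerBl. Qed.

Lemma diag_rec n : q n.+1 n.+1 = q n n - P n.+1 n.+1.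
Proof. by rewrite q_recS (q_out (ltnSn n)) add0r. Qed.

Lemma diag_noninc n : q n.+1 n.+1 <= q n n.
Proof. by rewrite diag_rec gerBl. Qed.

(** A boundary point has a single predecessor, so the mass only decreases along the boundary, and it
    ends at zero. *)
Lemma bottom_ge0 n : 0 <= q n 0%N.
Proof.
exact: (@noninc_ge0 _ (fun n => q n 0%N) 0 D (fun n _ => bottom_noninc n) (fun n => @q_top n 0)).
Qed.

Lemma diag_ge0 n : 0 <= q n n.
Proof.
exact: (@noninc_ge0 _ (fun n => q n n) 0 D (fun n _ => diag_noninc n) (fun n => @q_top n n)).
Qed.

Lemma q00_gt0 : 0 < q 0%N 0%N.
Proof. by have := h_gt0 (leq0n D); rewrite h0. Qed.

Lemma label_bottom e n : (n <= D)%N -> q n 0%N = 0 -> label e n 0 = e.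
Proof.
move=> lenD q0; rewrite label_right // ?addbF //.
by have := q0_side lenD q0; rewrite ltn0 orbF.
Qed.

(** A zero on the diagonal lies above the path, where its colour depends on the parity of n - n; so
    the diagonal never changes sign. *)
Lemma label_diag e n : (n <= D)%N -> label e n n.
Proof.
move=> lenD; have := diag_ge0 n; rewrite le0r => /predU1P[q0|]; last exact: label_gt0.
have := q0_side lenD q0; rewrite ltnNge h_le //= => hn.
by rewrite label_left // subnn.
Qed.

(** If nothing is kept at (n, b), its mass is the sum of two masses of the opposite weak sign, so
    all three vanish. They lie on one side of the path, where (n, b) has the colour of the
    predecessor in its row or column. *)
Lemma mono_gt0 e n b : mono D (label e) n b -> 0 < P n b.
Proof.
case: n => // n; rewrite /mono; case: (leqP n.+1 D) => [ltnD|leDn].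
  case: eqP => [-> |/eqP b0].
    case El: (label e n 0); case El': (label e n.+1 0) => // _.
    - have q1 := label_le0 El'.
      have q1' : q n.+1 0%N = 0 by apply/eqP; rewrite eq_le q1 bottom_ge0.
      have e0 : e = false by rewrite -El' label_bottom.
      have -> : P n.+1 0%N = q n 0%N by have := q_rec0 n; rewrite q1'; lra.
      rewrite lt0r bottom_ge0 andbT; apply/eqP => q0.
      by move: El; rewrite label_bottom ?e0 // ltnW.
    - have q0 : q n 0%N = 0 by apply/eqP; rewrite eq_le (label_le0 El) bottom_ge0.
      have q1 : q n.+1 0%N = 0.
        by apply/eqP; rewrite eq_le bottom_ge0 andbT -q0 bottom_noninc.
      by move: El El'; rewrite !label_bottom ?(ltnW ltnD) // => ->.
  case: eqP => [bn|/eqP bn]; first by rewrite !label_diag ?(ltnW ltnD).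
  case: b b0 bn => // b _ bn /= /and3P[ltbn /eqP Ep Ez].
  rewrite lt0r P_ge0 andbT; apply/eqP => P0; have qE := q_recS n b; rewrite P0 subr0 in qE.
  have [q1 [q2 q3]] : q n b.+1 = 0 /\ q n b = 0 /\ q n.+1 b.+1 = 0.
    case El: (label e n b) Ep => Ep; move: Ez; rewrite Ep; case Ez: (label e n.+1 b.+1) => // _.
      by have := label_ge0 El; have := label_ge0 Ep; have := label_le0 Ez; lra.
    by have := label_le0 El; have := label_le0 Ep; have := label_ge0 Ez; lra.
  have /orP[br|bl] := q0_side ltnD q3.
    by move: Ez; rewrite !label_right ?eqxx //; apply: right_pred.
  move: Ez; rewrite Ep !label_left ?subSS ?eqxx //; exact: left_pred.
case/and3P => /eqP[nD]; subst n; case: b => [//|b] /andP[_ ltbD] /eqP Ep.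
rewrite lt0r P_ge0 andbT; apply/eqP => P0; have qE := q_recS D b; rewrite P0 subr0 q_top // in qE.
have [q1 q2] : q D b.+1 = 0 /\ q D b = 0.
  case El: (label e D b) Ep => Ep.
    by have := label_ge0 El; have := label_ge0 Ep; lra.
  by have := label_le0 El; have := label_le0 Ep; lra.
(* No value of [h D] lies strictly between b and b+1, so both zeros are on one side, where
   neighbours on a level have opposite colours. *)
have s1 := q0_side (leqnn D) q1; have s2 := q0_side (leqnn D) q2.
have [hb|bh] := ltnP b.+1 (h D).
  by move: Ep; rewrite !label_right //= ?(ltnW hb) //; case: e; case: (odd b).
rewrite ltnS in ltbD; have hb : (h D < b)%N by lia.
have DB : (D - b = (D - b.+1).+1)%N by lia.
have hb1 : (h D < b.+1)%N by lia.
by move: Ep; rewrite (label_left _ q1 hb1) (label_left _ q2 hb) DB /=; case: (odd _).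
Qed.

Local Notation grid := ('I_D.+2 * 'I_D.+2)%type.

Definition terms : {set grid} :=
  [set x : grid | [&& (0 < x.1)%N, (x.2 <= x.1)%N & 0 < P x.1 x.2]].

Definition monos (e : bool) : {set grid} := [set x : grid | mono D (label e) x.1 x.2].

Definition outer_monos (e : bool) : {set grid} :=
  [set x : grid | mono D (label e) x.1 x.2 && outer D x.1 x.2].

Lemma monos_count e : (D + #|outer_monos e| <= 2 * #|monos e|)%N.
Proof.
rewrite /monos /outer_monos.
rewrite (card_pairs (p := fun n b => mono D (label e) n b && outer D n b)).
  by rewrite (card_pairs (p := mono D (label e))) ?mono_count // => n b /mono_le.
by move=> n b /andP[/mono_le].
Qed.

Lemma monos_sub e : monos e \subset terms.
Proof.
apply/subsetP => -[[n ltn] [b ltb]]; rewrite !inE /= => M.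
by rewrite (mono_le M) (mono_gt0 M) andbT; case: (n) M.
Qed.

Lemma mem_terms (n b : nat) (ltn : (n.+1 < D.+2)%N) (ltb : (b < D.+2)%N) :
  (b <= n.+1)%N -> 0 < P n.+1 b -> (Ordinal ltn, Ordinal ltb) \in terms.
Proof. by move=> lebn P_gt0; rewrite !inE /= lebn. Qed.

Lemma bottom_end : exists2 A, (A <= D)%N & 0 < q A 0%N /\ forall n, (A < n)%N -> q n 0%N = 0.
Proof.
exact: (@noninc_last _ (fun n => q n 0%N) 0 D (fun n _ => bottom_noninc n)
  (fun n => @q_top n 0) q00_gt0).
Qed.

Lemma diag_end : exists2 B, (B <= D)%N & 0 < q B B /\ forall n, (B < n)%N -> q n n = 0.
Proof.
exact: (@noninc_last _ (fun n => q n n) 0 D (fun n _ => diag_noninc n)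
  (fun n => @q_top n n) q00_gt0).
Qed.

Lemma bottom_end_mono A : 0 < q A 0%N -> q A.+1 0%N = 0 -> ~~ mono D (label true) A.+1 0.
Proof.
move=> q_gt0 q0; rewrite /mono eqxx; case: ifP => [leAD|_]; last by rewrite andbF.
by rewrite label_gt0 // label_bottom.
Qed.

Lemma diag_end_mono e B : ~~ mono D (label e) B.+1 B.+1.
Proof.
rewrite /mono eqxx; case: ifP => [leBD|_]; last by rewrite ltnn !andbF.
by rewrite !label_diag // ltnW.
Qed.

(** Where a boundary row runs out, its last mass is kept, which gives a pure power of x and one of
    y. With the colour [true] neither is a sign change, so both come on top of the terms found by
    [mono]. *)
Lemma pure_corners : exists A (ltA : (A.+1 < D.+2)%N) B (ltB : (B.+1 < D.+2)%N),
  [/\ 0 < q A 0%N, forall n, (A < n)%N -> q n 0%N = 0,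
      (Ordinal ltA, ord0) \in terms, (Ordinal ltB, Ordinal ltB) \in terms
    & (Ordinal ltA, ord0) \notin monos true].
Proof.
have [A leAD [qA qA0]] := bottom_end; have [B leBD [qB qB0]] := diag_end.
exists A, leAD, B, leBD; split => //.
- by apply: mem_terms => //; have := q_rec0 A; rewrite qA0 //; lra.
- by apply: mem_terms => //; have := diag_rec B; rewrite qB0 //; lra.
- by rewrite inE; apply: bottom_end_mono => //; apply: qA0.
Qed.

Lemma diag_notin_monos e B (ltB : (B.+1 < D.+2)%N) : (Ordinal ltB, Ordinal ltB) \notin monos e.
Proof. by rewrite inE diag_end_mono. Qed.

Lemma flow_bound : (D + 4 <= 2 * #|terms|)%N.
Proof.
have [A [ltA [B [ltB [_ _ tA tB nA]]]]] := pure_corners.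
have nB := diag_notin_monos true ltB.
suff : (#|monos true| + 2 <= #|terms|)%N by have := monos_count true; lia.
have sub : (Ordinal ltA, ord0) |: ((Ordinal ltB, Ordinal ltB) |: monos true) \subset terms.
  by rewrite !subUset !sub1set tA tB monos_sub.
apply: leq_trans (subset_leq_card sub); rewrite cardsU2_new //.
by rewrite xpair_eqE andbC.
Qed.

(* If the bottom row stops at A < D, then each of the two colourings accounts for all
   the terms.  Below the path this makes the rows vanish from level A+1 on, one after the
   other: where a row ends there is a term that one of the colourings misses.  So the
   path itself cannot reach level A+1. *)
Lemma flow_equality : ~~ odd D -> (2 * #|terms| <= D + 4)%N ->
  forall n, (0 < n <= D)%N -> P n 0%N = 0.
Proof.
move=> evenD small.
have [A [ltA [B [ltB [qA qA0 tA tB nA]]]]] := pure_corners.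
set cA := (Ordinal ltA, ord0) in tA nA; set cB := (Ordinal ltB, Ordinal ltB) in tB.
(* The count has no slack left: no outer triangle is counted, and every term except the two corners
   is. *)
have count_true : outer_monos true = set0 /\ terms = cA |: (cB |: monos true).
  have nB := diag_notin_monos true ltB; rewrite -/cB in nB.
  have sub : cA |: (cB |: monos true) \subset terms.
    by rewrite !subUset !sub1set tA tB monos_sub.
  have card2 : #|cA |: (cB |: monos true)| = (#|monos true| + 2)%N.
    by rewrite cardsU2_new // xpair_eqE andbC.
  have := subset_leq_card sub; rewrite card2 => c2.
  have [o0 tm] : #|outer_monos true| = 0%N /\ (#|terms| <= #|monos true| + 2)%N.
    move: (monos_count true) c2 small.
    by move: #|outer_monos true| #|monos true| #|terms| => o m t; lia.
  split; first exact: cards0_eq.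
  by apply/eqP; rewrite eq_sym eqEcard sub card2.
have [eqAD | neAD] := eqVneq A D.
  move=> n /andP[n_gt0 lenD]; case: n n_gt0 lenD => // n _ lenD.
  apply/eqP; rewrite eq_le P_ge0 andbT leNgt; apply/negP => Pn.
  have ltn : (n.+1 < D.+2)%N by rewrite ltnS ltnW.
  have := @mem_terms n 0 ltn (ltn0Sn _) (leq0n _) Pn.
  rewrite count_true.2 !inE => /or3P[/eqP[]|/eqP[]//|M].
    by lia.
  have : (Ordinal ltn, ord0) \in outer_monos true by rewrite inE; apply/andP; split.
  by rewrite count_true.1 inE.
have ltAD : (A.+1 <= D)%N by have := ltA; lia.
(* With the colour [false] the end of the bottom row is a sign change, hence a counted outer
   triangle. As [D] is even, this forces one more triangle, and only the corner on the diagonal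
   stays uncounted. *)
have count_false : terms = cB |: monos false.
  have nB := diag_notin_monos false ltB; rewrite -/cB in nB.
  have sub : cB |: monos false \subset terms by rewrite subUset sub1set tB monos_sub.
  have mA : cA \in outer_monos false.
    rewrite inE /= /mono ltAD; apply/andP; split => //=.
    by rewrite label_gt0 // label_bottom // qA0.
  have o_gt0 : (0 < #|outer_monos false|)%N by apply/card_gt0P; exists cA.
  apply/eqP; rewrite eq_sym eqEcard sub cardsU1 nB.
  move: (monos_count false) small o_gt0 evenD.
  by move: #|outer_monos false| #|monos false| #|terms| => o m t; lia.
have term_mono e n b : (n <= D)%N -> (b < n)%N -> 0 < P n.+1 b.+1 -> mono D (label e) n.+1 b.+1.
  move=> lenD ltbn Pn; have ltb : (b.+1 < D.+2)%N by lia.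
  have := @mem_terms n b.+1 lenD ltb (ltnW ltbn) Pn.
  case: e; first rewrite count_true.2; last rewrite count_false.
    rewrite !inE => /or3P[/eqP[]//|/eqP[] |//]; lia.
  rewrite !inE => /orP[/eqP[] |//]; lia.
have q0 b : (b <= h A.+1)%N -> forall n, (A < n)%N -> q n b = 0.
  elim: b => [_ //|b IHb ltbh]; have qb0 := IHb (ltnW ltbh).
  have noninc n : (A.+1 <= n)%N -> q n.+1 b.+1 <= q n b.+1.
    by move=> ltAn; rewrite q_recS qb0 // addr0 gerBl.
  have qb_top n : (D < n)%N -> q n b.+1 = 0 by move=> ?; apply: q_top.
  have qb_ge0 := @noninc_ge0 _ (q^~ b.+1) _ _ noninc qb_top.
  have [qAb | ] := eqVneq (q A.+1 b.+1) 0.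
    move=> n ltAn; apply/eqP; rewrite eq_le (qb_ge0 _ ltAn) andbT -qAb.
    exact: (@noninc_leq _ (q^~ b.+1) _ noninc).
  move=> qAb; have {}qAb : 0 < q A.+1 b.+1 by rewrite lt0r qAb (qb_ge0 _ (leqnn _)).
  have [E /andP[leAE leED] [qE qE0]] := @noninc_last _ (q^~ b.+1) _ _ noninc qb_top qAb.
  have ltbE : (b < E)%N by rewrite ltnNge; apply: contraTN qE => ltE; rewrite q_out ?ltxx.
  have PE : 0 < P E.+1 b.+1 by have := q_recS E b; rewrite qE0 // qb0 //; lra.
  have hE : (b < h E)%N by apply: leq_trans ltbh (h_mono leAE leED).
  (* The colour [odd b] makes the zero at (E, b) negative while (E, b+1) is positive, so this
     colouring misses the term at (E+1, b+1). *)
  have := term_mono (odd b) _ _ leED ltbE PE.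
  have lE1 : label (odd b) E b.+1 by apply: label_gt0.
  have lE0 : label (odd b) E b = false by rewrite label_right ?qb0 // addbb.
  rewrite /mono eqSS (ltn_eqF ltbE) lE1 lE0 /= andbF; case: ltnP => // leDE.
  have ED : E = D by apply/eqP; rewrite eqn_leq leED.
  by rewrite -{2 3}ED lE1 lE0 !andbF.
by have := h_gt0 ltAD; rewrite q0 ?ltxx.
Qed.

End Flow.

(** * The degree bound *)

Definition mxy (a b : nat) : 'X_{1..2} := [multinom (if i == 0%R then a else b) | i < 2].

Lemma mxyE0 a b : mxy a b 0 = a. Proof. by rewrite mnmE. Qed.

Lemma mxyE1 a b : mxy a b 1 = b. Proof. by rewrite mnmE. Qed.

Lemma ord2_ind (P : 'I_2 -> Prop) : P 0 -> P 1 -> forall i, P i.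
Proof.
move=> P0 P1 [[|[|//]] lt_i].
- by rewrite (_ : Ordinal _ = 0) //; apply: val_inj.
- by rewrite (_ : Ordinal _ = 1) //; apply: val_inj.
Qed.

Lemma mnm2E (m : 'X_{1..2}) : m = mxy (m 0) (m 1).
Proof. by apply/mnmP; apply: ord2_ind; rewrite mnmE. Qed.

Lemma mxy_inj a b a' b' : mxy a b = mxy a' b' -> a = a' /\ b = b'.
Proof.
by move=> E; split; [rewrite -(mxyE0 a b) E mxyE0 | rewrite -(mxyE1 a b) E mxyE1].
Qed.

Lemma mxy_eq a b a' b' : (mxy a b == mxy a' b') = (a == a') && (b == b').
Proof. by apply/eqP/andP => [/mxy_inj[-> ->] // | [/eqP-> /eqP->]]. Qed.

Lemma mdeg_mxy a b : mdeg (mxy a b) = (a + b)%N.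
Proof. by rewrite mdegE !big_ord_recl big_ord0 addn0 !mnmE. Qed.

Lemma mdeg2E (m : 'X_{1..2}) : mdeg m = (m 0%R + m 1%R)%N.
Proof. by rewrite {1}[m]mnm2E mdeg_mxy. Qed.

(** * The mass flow of a polynomial *)

Section Bivariate.
Variable R : realType.
Implicit Types (p : {mpoly R[2]}) (v : 'I_2 -> R).

Lemma msize_eqP p d : msize p = d.+1 <->
  (forall m, p@_m != 0 -> (mdeg m <= d)%N) /\ (exists2 m, p@_m != 0 & mdeg m = d).
Proof.
split=> [sp | [le_d [m pm md]]].
  split=> [m pm|]; first by rewrite -ltnS -sp; apply: msize_mdeg_lt; rewrite mcoeff_msupp.
  have p_neq0 : p != 0 by apply/eqP => p0; move: sp; rewrite p0 msize0.
  exists (mlead p); first by rewrite -mcoeff_msupp mlead_supp.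
  by apply: succn_inj; rewrite -sp; exact: mlead_deg.
apply/eqP; rewrite eqn_leq; apply/andP; split.
  by rewrite msizeE; apply/bigmax_leqP_seq => k; rewrite mcoeff_msupp => pk _; exact: le_d.
by rewrite -md; apply: msize_mdeg_lt; rewrite mcoeff_msupp.
Qed.

Lemma meval_mxy v a b : ('X_[R, mxy a b]).@[v] = v 0 ^+ a * v 1 ^+ b.
Proof.
rewrite mevalX !big_ord_recl big_ord0 mulr1.
by rewrite (_ : lift ord0 ord0 = 1) ?mnmE //; apply: val_inj.
Qed.

Lemma mpoly_levels p d : (msize p <= d.+1)%N ->
  p = \sum_(n < d.+1) \sum_(b < n.+1) p@_(mxy (n - b) b) *: 'X_[mxy (n - b) b].
Proof.
move=> sp; apply/mpolyP => m; rewrite raddf_sum /=.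
under eq_bigr => n _.
  rewrite raddf_sum /=; under eq_bigr => b _ do rewrite mcoeffZ mcoeffX.
  over.
have lt0 (n b : nat) : (b <= n)%N -> mxy (n - b) b = m -> n = mdeg m /\ b = m 1.
  by move=> lebn <-; rewrite mdeg_mxy mxyE1 subnK.
have [ltmd|] := ltnP (mdeg m) d.+1; last first.
  move=> ledm; rewrite memN_msupp_eq0 ?msize_mdeg_ge ?(leq_trans sp) //.
  rewrite big1 // => n _; rewrite big1 // => b _.
  case: eqP => [E|]; last by rewrite mulr0.
  have [nm _] := lt0 n b (ltn_ord b) E; have := ltn_ord n; lia.
have ltm1 : (m 1%R < (mdeg m).+1)%N by rewrite mdeg2E ltnS leq_addl.
rewrite (bigD1 (Ordinal ltmd)) //= (bigD1 (Ordinal ltm1)) //=.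
have mE : mxy (mdeg m - m 1%R) (m 1%R) = m by rewrite mdeg2E addnK -mnm2E.
rewrite mE eqxx mulr1.
rewrite big1 ?addr0 => [|b nb]; last first.
  case: eqP => [E|]; last by rewrite mulr0.
  by case/eqP: nb; apply: val_inj; have [] := lt0 (mdeg m) b (ltn_ord b) E.
rewrite big1 ?addr0 => // n nn.
rewrite big1 // => b _; case: eqP => [E|]; last by rewrite mulr0.
by case/eqP: nn; apply: val_inj; have [] := lt0 n b (ltn_ord b) E.
Qed.

Lemma meval_levels p d v : (msize p <= d.+1)%N ->
  p.@[v] = \sum_(n < d.+1) \sum_(b < n.+1) p@_(mxy (n - b) b) * (v 0 ^+ (n - b) * v 1 ^+ b).
Proof.
move=> sp; rewrite {1}(mpoly_levels sp) raddf_sum; apply: eq_bigr => n _.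
by rewrite raddf_sum; apply: eq_bigr => b _; rewrite /= mevalZ meval_mxy.
Qed.

(** The homogeneous part of degree [n] at x = 1, with ['X] for y. *)
Definition level p (n : nat) : {poly R} := \poly_(b < n.+1) p@_(mxy (n - b) b).

Lemma coef_level p n b : (level p n)`_b = if (b <= n)%N then p@_(mxy (n - b) b) else 0.
Proof. by rewrite coef_poly ltnS. Qed.

(* The mass flow: unit mass enters at 1, the monomial m keeps the mass p@_m
   and passes the remaining mass to both m * x and m * y. *)
Fixpoint flow p (n : nat) : {poly R} :=
  if n is m.+1 then (1 + 'X) * flow p m - level p n else 1 - level p 0.

(** Unrolled, the flow is 1 - p truncated at degree [n], homogenised by powers of x + y and taken at
    x = 1. *)
Lemma flow_sum p n :
  flow p n = (1 + 'X) ^+ n - \sum_(i < n.+1) (1 + 'X) ^+ (n - i) * level p i.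
Proof.
elim: n => [|n IHn]; first by rewrite big_ord_recl big_ord0 addr0 subn0 expr0 mul1r.
rewrite big_ord_recr /= subnn expr0 mul1r IHn mulrBr -exprS opprD addrA mulr_sumr.
congr (_ - _ - _); apply: eq_bigr => i _; rewrite mulrA -exprS subSn //.
by rewrite -ltnS.
Qed.

Lemma poly_eq0_on_nat (f : {poly R}) : (forall k : nat, f.[k%:R] = 0) -> f = 0.
Proof.
move=> f0; apply/eqP; apply: contraT => f_neq0.
have := max_poly_roots (rs := [seq k%:R : R | k <- iota 0 (size f)]) f_neq0.
rewrite size_map size_iota ltnn => -> //.
  by apply/allP => _ /mapP[k _ ->]; rewrite /root f0.
by rewrite map_inj_uniq ?iota_uniq // => j k /eqP; rewrite eqr_nat => /eqP.
Qed.

Lemma flow_end p d : (forall v, v 0 + v 1 = 1 -> p.@[v] = 1) -> (msize p <= d.+1)%N ->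
  flow p d = 0.
Proof.
move=> p1 sp; apply: poly_eq0_on_nat => k; set t : R := k%:R.
have t1 : 1 + t != 0 by rewrite lt0r_neq0 // ltr_wpDr // ler0n.
(* The point of x + y = 1 with y/x = t; p(v) = 1 times (1+t)^d is the homogenised identity at t. *)
pose v (i : 'I_2) : R := if i == 0 then (1 + t)^-1 else t / (1 + t).
have v1 : v 0 + v 1 = 1 by rewrite /v /= -[X in X + _]mul1r -mulrDl divff.
rewrite flow_sum hornerD hornerN horner_sum horner_exp !hornerE.
apply/eqP; rewrite subr_eq0; apply/eqP.
transitivity ((1 + t) ^+ d * p.@[v]); first by rewrite p1 // mulr1.
rewrite (meval_levels v sp) mulr_sumr; apply: eq_bigr => n _.
rewrite hornerM horner_exp !hornerE horner_poly !mulr_sumr.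
apply: eq_bigr => b _; rewrite /v /=.
have lebn : (b <= n)%N by rewrite -ltnS.
have lend : (n <= d)%N by rewrite -ltnS.
rewrite expr_div_n exprVn.
have -> : (1 + t) ^+ d = (1 + t) ^+ (d - n) * ((1 + t) ^+ (n - b) * (1 + t) ^+ b).
  by rewrite -!exprD !subnK.
have tn := expf_neq0 (n - b) t1; have tb := expf_neq0 b t1.
by field; rewrite tn tb.
Qed.

Lemma flow_rec0 p n : (flow p n.+1)`_0 = (flow p n)`_0 - (level p n.+1)`_0.
Proof. by rewrite coefB mulrDl mul1r coefD coefXM addr0. Qed.

Lemma flow_recS p n b :
  (flow p n.+1)`_b.+1 = (flow p n)`_b.+1 + (flow p n)`_b - (level p n.+1)`_b.+1.
Proof. by rewrite coefB mulrDl mul1r coefD coefXM. Qed.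

Lemma flow_out p n b : (n < b)%N -> (flow p n)`_b = 0.
Proof.
elim: n b => [|n IHn] [|b] //.
  by rewrite coefB coef_level coef1 /= subr0.
move=> ltnb; rewrite flow_recS (IHn b.+1 (ltnW ltnb)) (IHn b ltnb).
by rewrite coef_level leqNgt ltnb subr0 addr0.
Qed.

End Bivariate.

(** Keeping mass only lowers a value, so a positive value has a positive predecessor; the path is
    built backwards from (n, b). *)
Lemma exists_path (R : realFieldType) (q P : nat -> nat -> R) n b :
  (forall n b, 0 <= P n b) ->
  (forall n, q n.+1 0%N = q n 0%N - P n.+1 0%N) ->
  (forall n b, q n.+1 b.+1 = q n b.+1 + q n b - P n.+1 b.+1) ->
  0 < q n b ->
  exists h : nat -> nat, [/\ h n = b, forall m, (m <= n)%N -> 0 < q m (h m)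
    & forall m, (m < n)%N -> (h m <= h m.+1 <= (h m).+1)%N].
Proof.
move=> P0 rec0 recS; elim: n b => [|n IHn] b qb.
  by exists (fun=> b); split => // m; rewrite leqn0 => /eqP->.
have [c qc /andP[lecb lebc]] : exists2 c, 0 < q n c & (c <= b <= c.+1)%N.
  case: b qb => [|b] qb.
    by exists 0%N => //; have := rec0 n; have := P0 n.+1 0%N; lra.
  have [?|qb1] := ltP 0 (q n b.+1); first by exists b.+1; rewrite // leqnn leqnSn.
  exists b; last by rewrite leqnn leqnSn.
  by have := recS n b; have := P0 n.+1 b.+1; lra.
have [h [hn h_gt0 h_step]] := IHn c qc.
exists (fun m => if (m <= n)%N then h m else b); split => [|m|m].
- by rewrite ltnn.
- by rewrite leq_eqVlt => /predU1P[->|]; [rewrite ltnn | rewrite ltnS => /[dup] /h_gt0 + ->].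
- rewrite ltnS => lemn; move: (lemn); rewrite {1}leq_eqVlt => /predU1P[->|ltmn].
    by rewrite leqnn ltnn hn lecb.
  by rewrite lemn ltmn h_step.
Qed.

Section Bound.
Variable R : realType.
Implicit Types (p : {mpoly R[2]}).

(** A monomial of top degree keeps all it receives, since the flow vanishes at level [D.+1]. So one
    of its predecessors is positive, and the path is traced back from there. *)
Lemma H2_path p D : in_H2d D.+1 p -> exists h : nat -> nat,
  [/\ forall n, (n <= D)%N -> 0 < (flow p n)`_(h n),
      forall n, (n < D)%N -> (h n <= h n.+1 <= (h n).+1)%N & h 0 = 0%N].
Proof.
move=> [[p_ge0 p1] sp].
have lev_ge0 n b : 0 <= (level p n)`_b by rewrite coef_level; case: ifP.
have top n : (D < n)%N -> flow p n = 0 by move=> ltDn; apply: flow_end => //; rewrite sp ltnS.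
have [b qb] : exists b, 0 < (flow p D)`_b.
  have [_ [m pm md]] := (msize_eqP p D.+1).1 sp.
  have lem : (m 1%R <= D.+1)%N by rewrite -md mdeg2E leq_addl.
  have P_gt0 : 0 < (level p D.+1)`_(m 1%R).
    by rewrite coef_level lem -md mdeg2E addnK -mnm2E lt0r pm p_ge0.
  case: (m 1%R) P_gt0 => [|b] P_gt0.
    by exists 0%N; have := flow_rec0 p D; rewrite top // coef0; lra.
  have := flow_recS p D b; rewrite top // coef0 => E.
  have [?|] := ltP 0 (flow p D)`_b; first by exists b.
  by exists b.+1; lra.
have [h [hD h_gt0 h_step]] := exists_path lev_ge0 (@flow_rec0 _ p) (@flow_recS _ p) qb.
exists h; split => //.
case h0 : (h 0) => [//|c]; have := h_gt0 0 isT.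
by rewrite h0 flow_out // ltxx.
Qed.

(** [terms] begins at level 1; counting the constant term apart lets equality in the bound force it
    to vanish. *)
Lemma card_terms_le p D : (forall m, 0 <= p@_m) ->
  (#|terms D (fun n b => (level p n)`_b)%R| + (p@_(mxy 0 0) != 0%R) <= nterms p)%N.
Proof.
move=> p_ge0; set T := terms D _.
pose mon (x : 'I_D.+2 * 'I_D.+2) := mxy (x.1 - x.2) x.2.
have monP x : x \in T -> mon x \in msupp p /\ (mdeg (mon x) = x.1 :> nat) /\ (0 < x.1)%N.
  rewrite inE => /and3P[x1 lex]; rewrite coef_level lex mcoeff_msupp => /lt0r_neq0 px.
  by rewrite mdeg_mxy subnK.
rewrite cardE -(size_map mon).
set c := (p@_(mxy 0 0) != 0%R).
have -> : (size (map mon (enum T)) + c = size (nseq c (mxy 0 0) ++ map mon (enum T)))%N.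
  by rewrite size_cat size_nseq addnC.
apply: uniq_leq_size.
  rewrite cat_uniq; apply/and3P; split.
  - by case: c.
  - apply/hasPn => m /mapP[x]; rewrite mem_enum => /monP[_ [xd x_gt0]] ->.
    rewrite mem_nseq negb_and orbC; apply/orP; left; apply: contraTneq x_gt0 => mx.
    by rewrite -xd mx mdeg_mxy.
  - rewrite map_inj_in_uniq ?enum_uniq // => x y; rewrite !mem_enum.
    move=> /monP[_ [xd _]] /monP[_ [yd _]] /[dup] E /mxy_inj[_ E2].
    case: x y xd yd E E2 => x1 x2 [y1 y2] /= xd yd E E2.
    by congr (_, _); apply: val_inj => //=; rewrite -xd -yd E.
move=> m; rewrite mem_cat mem_nseq => /orP[/andP[c_gt0 /eqP->]|/mapP[x]].
  by rewrite mcoeff_msupp; move: c_gt0; rewrite /c; case: eqP.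
by rewrite mem_enum => /monP[? _] ->.
Qed.

Theorem degree_bound p d : (0 < d)%N -> in_H2d d p -> (d + 3 <= 2 * nterms p)%N.
Proof.
case: d => // D _ Hp; have [h [h_gt0 h_step h0]] := H2_path Hp.
have [[p_ge0 p1] sp] := Hp.
have := card_terms_le D p_ge0.
have := @flow_bound _ D (fun n b => (flow p n)`_b) (fun n b => (level p n)`_b) h.
move=> /(_ _ _ _ _ _ h_gt0 h_step h0) bound.
suff : (D + 4 <= 2 * #|terms D (fun n b => (level p n)`_b)%R|)%N.
  by move: #|terms D _| => t; case: (_ != _); lia.
apply: bound => [n b|n b|n b|n|n b].
- by rewrite coef_level; case: ifP.
- exact: flow_out.
- by move=> ltDn; rewrite flow_end ?coef0 // sp ltnS.
- exact: flow_rec0.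
- exact: flow_recS.
Qed.

Lemma sharp_bottom p D : ~~ odd D -> in_H2d D.+1 p -> (2 * nterms p <= D + 4)%N ->
  p@_(mxy 0 0) = 0 /\ forall n, (0 < n <= D)%N -> p@_(mxy n 0) = 0.
Proof.
move=> evenD Hp small; have [h [h_gt0 h_step h0]] := H2_path Hp.
have [[p_ge0 p1] sp] := Hp.
have lev_ge0 n b : 0 <= (level p n)`_b by rewrite coef_level; case: ifP.
have top n b : (D < n)%N -> (flow p n)`_b = 0.
  by move=> ltDn; rewrite flow_end ?coef0 // sp ltnS.
have := card_terms_le D p_ge0.
have bound := @flow_bound _ D (fun n b => (flow p n)`_b) (fun n b => (level p n)`_b) h
  lev_ge0 (@flow_out _ p) top (@flow_rec0 _ p) (@flow_recS _ p) h_gt0 h_step h0.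
have := @flow_equality _ D (fun n b => (flow p n)`_b) (fun n b => (level p n)`_b) h
  lev_ge0 (@flow_out _ p) top (@flow_rec0 _ p) (@flow_recS _ p) h_gt0 h_step h0 evenD.
move: bound; move: #|terms D _| => t bound eqn tn; split.
  by apply/eqP; apply: contraLR tn => ->; lia.
move=> n nD; have t_small : (2 * t <= D + 4)%N by move: tn; case: (_ != _); lia.
by have := eqn t_small n nD; rewrite coef_level subn0.
Qed.

Definition swap p : {mpoly R[2]} := msym (tperm 0 1) p.

Lemma swap_coef p a b : (swap p)@_(mxy a b) = p@_(mxy b a).
Proof.
rewrite mcoeff_sym; congr (p@_ _); apply/mnmP; apply: ord2_ind; rewrite !mnmE.
  by rewrite tpermL.
by rewrite tpermR.
Qed.

Lemma swap_eval p v : (swap p).@[v] = p.@[fun i => v (tperm 0 1 i)].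
Proof.
rewrite [RHS]mevalE /swap /msym raddf_sum; apply: eq_bigr => m _.
rewrite /= mevalM mevalC; congr (_ * _); rewrite /mmap1 rmorph_prod.
by apply: eq_bigr => i _; rewrite rmorphXn /= mevalXU.
Qed.

Lemma swap_H2d p d : in_H2d d p -> in_H2d d (swap p).
Proof.
move=> [[p_ge0 p1] /msize_eqP[le_d [m pm md]]]; split.
  split=> [k|v v1]; first by rewrite [k]mnm2E swap_coef.
  by rewrite swap_eval p1 // tpermL tpermR addrC.
apply/msize_eqP; split=> [k|].
  rewrite [k]mnm2E swap_coef => /le_d; by rewrite !mdeg_mxy addnC.
exists (mxy (m 1%R) (m 0%R)); first by rewrite swap_coef -mnm2E.
by rewrite mdeg_mxy addnC -mdeg2E.
Qed.

Lemma nterms_swap_le p : (nterms (swap p) <= nterms p)%N.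
Proof.
rewrite /nterms -(size_map (fun m : 'X_{1..2} => mxy (m 1%R) (m 0%R))).
apply: uniq_leq_size => [|k /mapP[m mp ->]].
  rewrite map_inj_uniq // => m k /mxy_inj[E1 E0].
  by rewrite [m]mnm2E [k]mnm2E E0 E1.
by move: mp; rewrite {1}[m]mnm2E !mcoeff_msupp swap_coef.
Qed.

Lemma sharp_left p D : ~~ odd D -> in_H2d D.+1 p -> (2 * nterms p <= D + 4)%N ->
  forall n, (0 < n <= D)%N -> p@_(mxy 0 n) = 0.
Proof.
move=> evenD /swap_H2d Hp small n nD; rewrite -swap_coef.
have := nterms_swap_le p => le_sw.
by apply: (sharp_bottom evenD Hp _).2 => //; lia.
Qed.

End Bound.

(** * Trading terms in Lucas polynomials *)

Section TermLists.
Variable R : realType.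
Implicit Types (l : seq (R * (nat * nat))) (t : R * (nat * nat)).

(** A list may repeat a monomial or carry a zero coefficient, so its length only bounds the number
    of terms from above. *)
Definition of_terms l : {mpoly R[2]} := \sum_(t <- l) t.1 *: 'X_[mxy t.2.1 t.2.2].

Lemma of_terms_coef l m : (of_terms l)@_m = \sum_(t <- l) t.1 * (mxy t.2.1 t.2.2 == m)%:R.
Proof.
by rewrite raddf_sum; apply: eq_bigr => t _; rewrite /= mcoeffZ mcoeffX.
Qed.

Lemma of_terms_coef_out l a b : (a, b) \notin [seq t.2 | t <- l] -> (of_terms l)@_(mxy a b) = 0.
Proof.
move=> nl; rewrite of_terms_coef big_seq big1 // => -[c [a' b']] /= tl.
rewrite mxy_eq; case: andP => [[/eqP aE /eqP bE]|]; last by rewrite mulr0.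
by case/mapP: nl; exists (c, (a', b')); rewrite //= aE bE.
Qed.

Lemma of_terms_coef_ge0 l m : (forall t, t \in l -> 0 <= t.1) -> 0 <= (of_terms l)@_m.
Proof.
move=> l_ge0; rewrite of_terms_coef big_seq sumr_ge0 // => t /l_ge0 t0.
by rewrite mulr_ge0.
Qed.

Lemma of_terms_coef_gt0 l t : (forall t, t \in l -> 0 <= t.1) -> t \in l -> 0 < t.1 ->
  0 < (of_terms l)@_(mxy t.2.1 t.2.2).
Proof.
move=> l_ge0 tl t_gt0; rewrite of_terms_coef (big_rem t) //= eqxx mulr1 ltr_wpDr //.
rewrite big_seq sumr_ge0 // => u /mem_rem /l_ge0 u0; exact: mulr_ge0.
Qed.

Lemma of_terms_nterms l : (nterms (of_terms l) <= size l)%N.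
Proof.
rewrite /nterms -(size_map (fun t => mxy t.2.1 t.2.2) l).
apply: uniq_leq_size => [|m]; first exact: msupp_uniq.
rewrite [m]mnm2E mcoeff_msupp => nz; apply: contraNT nz => nl.
apply/eqP; apply: of_terms_coef_out; apply: contra nl => /mapP[t tl E].
by apply/mapP; exists t; rewrite // -E.
Qed.

Lemma of_terms_H2d l d t :
  (forall t, t \in l -> 0 <= t.1 /\ (t.2.1 + t.2.2 <= d)%N) ->
  t \in l -> 0 < t.1 -> (t.2.1 + t.2.2)%N = d ->
  (forall x y : R, x + y = 1 -> \sum_(u <- l) u.1 * (x ^+ u.2.1 * y ^+ u.2.2) = 1) ->
  in_H2d d (of_terms l).
Proof.
move=> lP tl t_gt0 td l1; have l_ge0 u : u \in l -> 0 <= u.1 by case/lP.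
split; first split=> [m|v /l1 <-].
- exact: of_terms_coef_ge0.
- by rewrite raddf_sum; apply: eq_bigr => u _; rewrite /= mevalZ meval_mxy.
apply/msize_eqP; split=> [m|].
  rewrite [m]mnm2E => nz; have /mapP[u ul E] : (m 0, m 1) \in [seq u.2 | u <- l].
    by apply: contraNT nz => /of_terms_coef_out->.
  by rewrite mdeg_mxy; have [_] := lP u ul; rewrite -E.
exists (mxy t.2.1 t.2.2); first exact: lt0r_neq0 (of_terms_coef_gt0 _ tl _).
by rewrite mdeg_mxy.
Qed.

(** By the degree bound, twice either number of terms is the even one of d + 3 and d + 4, so both
    numbers agree and are minimal. A monomial of g missing from f and from its swap then refutes
    equivalence. *)
Lemma not_unique d (f g : {mpoly R[2]}) a b : (0 < d)%N ->
  in_H2d d f -> in_H2d d g ->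
  (2 * nterms f <= d + 4)%N -> (2 * nterms g <= d + 4)%N ->
  g@_(mxy a b) != 0 -> f@_(mxy a b) = 0 -> f@_(mxy b a) = 0 -> ~ uniqueness R d.
Proof.
move=> d_gt0 Hf Hg nf ng gab fab fba uniq.
have bf := degree_bound d_gt0 Hf; have bg := degree_bound d_gt0 Hg.
have nfg : nterms f = nterms g by lia.
have [[h [Hh nh]]||] := uniq f g Hf Hg nfg.
- by have := degree_bound d_gt0 Hh; lia.
- by move=> fg; rewrite -fg fab eqxx in gab.
- by move=> fg; move: gab; rewrite -swap_coef -[swap g]fg fba eqxx.
Qed.

End TermLists.

(* The Lucas polynomial sum_j lucas n j x^(n-2j) y^j is u^n + v^n where
   x = u + v and y = - u v. *)
Fixpoint lucas (n j : nat) : nat :=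
  match n with
  | 0 => if j is 0 then 2 else 0
  | 1 => j == 0%N
  | (n''.+1 as n').+1 => lucas n' j + (if j is i.+1 then lucas n'' i else 0)
  end.

Arguments lucas : simpl never.

Lemma lucasSS n j :
  lucas n.+2 j = (lucas n.+1 j + (if j is i.+1 then lucas n i else 0))%N.
Proof. by []. Qed.

Lemma lucas_0 n : lucas n.+1 0 = 1%N.
Proof. by elim: n => // n IHn; rewrite lucasSS IHn. Qed.

Lemma nat_ind2 (Q : nat -> Prop) : Q 0%N -> Q 1%N ->
  (forall n, Q n -> Q n.+1 -> Q n.+2) -> forall n, Q n.
Proof.
move=> Q0 Q1 QS n; suff [] : Q n /\ Q n.+1 by [].
by elim: n => // n [Qn QSn]; split=> //; apply: QS.
Qed.

Lemma lucas_out n j : (n < j.*2)%N -> lucas n j = 0%N.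
Proof.
elim/nat_ind2: n j => [[|j]|[|j]|n IH0 IH1 [|j]] // nj.
by rewrite lucasSS IH0 ?IH1 //; move: nj; rewrite doubleS; lia.
Qed.

Lemma lucas_double j : lucas j.*2 j = 2%N.
Proof.
by elim: j => // j IHj; rewrite doubleS lucasSS IHj lucas_out // doubleS.
Qed.

(** The closed form n/(n-j) * 'C(n-j, j) with n = 2j + a, cleared of denominators; a double
    induction follows the recursion. *)
Lemma lucas_fact j a :
  ((j + a) * (lucas (j.*2 + a) j * (j`! * a`!)) = (j.*2 + a) * (j + a)`!)%N.
Proof.
elim: j a => [|j IHj] a.
  by case: a => // a; rewrite !add0n lucas_0 fact0 !mul1n.
elim: a => [|a IHa].
  by rewrite !addn0 lucas_double fact0; lia.
have ja0 : (0 < j + a.+1)%N by lia.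
have -> : ((j.+1).*2 + a.+1 = (j.*2 + a.+1).+2)%N by lia.
have -> : (j.+1 + a.+1 = (j + a.+1).+1)%N by lia.
rewrite lucasSS [in RHS]factS.
have := IHj a.+1; move: IHa.
have -> : ((j.+1).*2 + a = (j.*2 + a.+1).+1)%N by lia.
have -> : (j.+1 + a = j + a.+1)%N by lia.
rewrite (factS j) (factS a) => E1 E0.
have E : ((j + a.+1) * ((lucas (j.*2 + a.+1).+1 j.+1 + lucas (j.*2 + a.+1) j) *
    (j.+1 * j`! * (a.+1 * a`!))) = (j + a.+1) * ((j.*2 + a.+1).+2 * (j + a.+1)`!))%N.
  have := congr1 (muln a.+1) E1; have := congr1 (muln j.+1) E0.
  move: (lucas _ j.+1) (lucas _ j) (j`!) (a`!) (_`!) => D1 D0 fj fa f.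
  nia.
move/eqP: E; rewrite eqn_pmul2l // => /eqP->; lia.
Qed.

Lemma lucas_gt0 n j : (0 < n)%N -> (j.*2 <= n)%N -> (0 < lucas n j)%N.
Proof.
move=> n_gt0 jn; rewrite lt0n; apply/eqP => D0.
have := lucas_fact j (n - j.*2); rewrite subnKC // D0 mul0n muln0.
by have := fact_gt0 (j + (n - j.*2)); nia.
Qed.

(** Quotient of two instances of the closed form; later comparisons of coefficients go through
    it. *)
Lemma lucas_ratio n j : (j.*2.+2 <= n)%N ->
  (lucas n j.+1 * (j.+1 * (n - j.+1)) = (n - j.*2) * (n - j.*2).-1 * lucas n j)%N.
Proof.
move=> jn; have [a nE] : exists a, n = (j.*2 + a.+2)%N by exists (n - j.*2.+2)%N; lia.
have := lucas_fact j a.+2; have := lucas_fact j.+1 a; subst n.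
have -> : ((j.+1).*2 + a = j.*2 + a.+2)%N by lia.
have -> : (j + a.+2 = (j.+1 + a).+1)%N by lia.
have -> : (j.*2 + a.+2 - j.+1 = j.+1 + a)%N by lia.
have -> : (j.*2 + a.+2 - j.*2 = a.+2)%N by lia.
rewrite (factS (j.+1 + a)) (factS a.+1) (factS a) (factS j).
have fj := fact_gt0 j; have fa := fact_gt0 a; have f := fact_gt0 (j.+1 + a).
move: (lucas _ j.+1) (lucas _ j) (j`!) (a`!) ((j.+1 + a)`!) fj fa f => D1 D0 fj fa f fj0 fa0 f0.
move=> E1 E0.
have {}E0 : (D0 * (fj * (a.+2 * (a.+1 * fa))) = (j.*2 + a.+2) * f)%N.
  by apply/eqP; rewrite -(eqn_pmul2l (ltn0Sn (j.+1 + a))) E0 mulnCA.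
apply/eqP; rewrite -(eqn_pmul2r fj0) -(eqn_pmul2r fa0); apply/eqP.
nia.
Qed.

Section Failure.
Variable R : realType.

(** On x + y = 1, u and v are the roots of T^2 - xT - y = (T - 1)(T + y), that is 1 and -y. [N] is
    any range containing the nonzero coefficients. *)
Lemma lucas_eval (x y : R) n N : x + y = 1 -> (n < N.*2)%N ->
  \sum_(j < N) (lucas n j)%:R * (x ^+ (n - j.*2) * y ^+ j) = 1 + (- y) ^+ n.
Proof.
move=> xy; elim/nat_ind2: n N => [[|N] //|[|N] //|n IH0 IH1 [|N] // nN].
- move=> _; rewrite big_ord_recl big1 => [|i _]; last by rewrite mul0r.
  by rewrite /lucas /= !expr0; ring.
- move=> _; rewrite big_ord_recl big1 => [|i _]; last by rewrite mul0r.
  by rewrite /lucas /= !expr1 expr0 mul1r mulr1; lra.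
transitivity (x * (\sum_(j < N.+1) (lucas n.+1 j)%:R * (x ^+ (n.+1 - j.*2) * y ^+ j))
    + y * (\sum_(j < N) (lucas n j)%:R * (x ^+ (n - j.*2) * y ^+ j))); last first.
  rewrite IH0 ?IH1; [|lia|lia].
  by rewrite (_ : x = 1 - y); [rewrite !exprS; ring | rewrite -xy addrK].
(* Truncated subtraction affects the exponent only where the coefficient is zero. *)
have S (j : nat) : (lucas n.+1 j)%:R * (x ^+ (n.+2 - j.*2) * y ^+ j)
    = x * ((lucas n.+1 j)%:R * (x ^+ (n.+1 - j.*2) * y ^+ j)).
  have [jn|nj] := leqP j.*2 n.+1; last by rewrite lucas_out // !mul0r mulr0.
  by rewrite subSn // exprS; ring.
rewrite mulr_sumr big_ord_recl [in RHS]big_ord_recl lucasSS addn0 S -addrA; congr (_ + _).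
rewrite mulr_sumr -big_split /=; apply: eq_bigr => j _.
rewrite /bump add1n -S lucasSS natrD mulrDl doubleS !subSS exprS; ring.
Qed.

Definition lucas_terms (d : nat) : seq (R * (nat * nat)) :=
  [seq ((lucas d j)%:R, (d - j.*2, j)%N) | j <- iota 0 d./2.+1].

Definition sharp_terms (d : nat) : seq (R * (nat * nat)) :=
  (1, (0%N, d)) :: lucas_terms d.

Lemma half_lt d : (d < (d./2.+1).*2)%N.
Proof. by rewrite doubleS -{1}(odd_double_half d); case: (odd d) => /=; lia. Qed.

Lemma lucas_terms_eval d (x y : R) : x + y = 1 ->
  \sum_(u <- lucas_terms d) u.1 * (x ^+ u.2.1 * y ^+ u.2.2) = 1 + (- y) ^+ d.
Proof.
move=> xy; rewrite -(@lucas_eval x y d d./2.+1) ?half_lt //.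
by rewrite big_map -[RHS](big_mkord xpredT (fun j => (lucas d j)%:R * (x ^+ (d - j.*2) * y ^+ j)))
  /index_iota subn0.
Qed.

Lemma sharp_H2d d : odd d -> in_H2d d (of_terms (sharp_terms d)).
Proof.
move=> odd_d; apply: (of_terms_H2d (t := (1, (0%N, d)))) => //=.
- move=> t; rewrite inE => /predU1P[-> /=|/mapP[j]]; first by rewrite ler01.
  by rewrite mem_iota /= => jd -> /=; split; [exact: ler0n | lia].
- by rewrite inE eqxx.
- move=> x y xy; rewrite big_cons /= lucas_terms_eval // exprNn -signr_odd odd_d.
  by rewrite expr0 expr1; ring.
Qed.

Lemma sharp_nterms d : odd d -> (2 * nterms (of_terms (sharp_terms d)) <= d + 3)%N.
Proof.
move=> odd_d; have := of_terms_nterms (sharp_terms d); rewrite /= size_map size_iota.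
by have := odd_double_half d; rewrite odd_d; lia.
Qed.

Lemma sharp_coef0 d a b : (a, b) != (0, d)%N -> (a + b.*2 != d)%N ->
  (of_terms (sharp_terms d))@_(mxy a b) = 0.
Proof.
move=> ab0 abd; apply: of_terms_coef_out; rewrite /sharp_terms map_cons in_cons negb_or ab0 andTb.
apply/negP => /mapP[t /mapP[j jd ->] /= [aE bE]].
by rewrite mem_iota in jd; have := half_lt d; lia.
Qed.

(* On x + y = 1 the identity sum_i lucas (2m) i x^(2m-2i) y^i = 1 + y^(2m)
   trades m + 1 terms for two; subtracting [lam * x^a * y^s] times it kills the
   terms number i1 and i2. *)
Definition traded_terms (d s m i1 i2 : nat) (lam : R) : seq (R * (nat * nat)) :=
  [:: (1, (0%N, d)); (lam, (d - (s + m).*2, s)%N);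
      (lam, (d - (s + m).*2, s + m.*2)%N)] ++
  [seq ((lucas d j)%:R - lam * (if (s <= j)%N then lucas m.*2 (j - s) else 0)%:R,
        (d - j.*2, j)%N) | j <- rem (s + i2)%N (rem (s + i1)%N (iota 0 d./2.+1))].

Section Trade.
Variables (d s m i1 i2 : nat) (lam : R).
Hypotheses (odd_d : odd d) (s_gt0 : (0 < s)%N) (smd : (s + m <= d./2)%N).
Hypotheses (lt12 : (i1 < i2)%N) (le2m : (i2 <= m)%N) (lam_gt0 : 0 < lam).
Hypothesis lam_le : forall i, (i <= m)%N -> lam * (lucas m.*2 i)%:R <= (lucas d (s + i))%:R.
Hypothesis lam_1 : lam * (lucas m.*2 i1)%:R = (lucas d (s + i1))%:R.
Hypothesis lam_2 : lam * (lucas m.*2 i2)%:R = (lucas d (s + i2))%:R.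

Let traded := traded_terms d s m i1 i2 lam.
Let c (j : nat) : R :=
  (lucas d j)%:R - lam * (if (s <= j)%N then lucas m.*2 (j - s) else 0)%:R.

Lemma traded_mem1 : (s + i1)%N \in iota 0 d./2.+1.
Proof. by rewrite mem_iota; lia. Qed.

Lemma traded_mem2 : (s + i2)%N \in rem (s + i1)%N (iota 0 d./2.+1).
Proof.
by rewrite mem_rem_uniq ?iota_uniq // inE eqn_add2l mem_iota; lia.
Qed.

Lemma traded_coef_ge0 j : 0 <= c j.
Proof.
rewrite /c; case: leqP => [lesj|_]; last by rewrite mulr0 subr0.
have [jm|mj] := leqP (j - s) m.
  by have := lam_le jm; rewrite subnKC // subr_ge0.
by rewrite (lucas_out (n := m.*2)) ?ltn_double // mulr0n mulr0 subr0.
Qed.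

Lemma traded_coef_killed i : lam * (lucas m.*2 i)%:R = (lucas d (s + i))%:R -> c (s + i) = 0.
Proof. by move=> E; rewrite /c leq_addr addKn E subrr. Qed.

Lemma traded_eval (x y : R) : x + y = 1 ->
  \sum_(u <- traded) u.1 * (x ^+ u.2.1 * y ^+ u.2.2) = 1.
Proof.
move=> xy; rewrite big_cat /= !big_cons big_nil /= big_map /=.
have -> : \sum_(j <- rem (s + i2)%N (rem (s + i1)%N (iota 0 d./2.+1)))
    ((lucas d j)%:R - lam * (if (s <= j)%N then lucas m.*2 (j - s) else 0)%:R)
      * (x ^+ (d - j.*2) * y ^+ j)
    = \sum_(j < d./2.+1) c j * (x ^+ (d - j.*2) * y ^+ j).
  rewrite -[RHS](big_mkord xpredT (fun j => c j * (x ^+ (d - j.*2) * y ^+ j))).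
  rewrite /index_iota subn0 (big_rem _ traded_mem1) (big_rem _ traded_mem2) /=.
  by rewrite !traded_coef_killed // !mul0r !add0r.
have -> : \sum_(j < d./2.+1) c j * (x ^+ (d - j.*2) * y ^+ j)
   = \sum_(j < d./2.+1) (lucas d j)%:R * (x ^+ (d - j.*2) * y ^+ j)
     - lam * \sum_(j < d./2.+1) (if (s <= j)%N then lucas m.*2 (j - s) else 0)%:R
        * (x ^+ (d - j.*2) * y ^+ j).
  rewrite mulr_sumr -sumrB; apply: eq_bigr => j _; rewrite /c; ring.
have -> : \sum_(j < d./2.+1) (if (s <= j)%N then lucas m.*2 (j - s) else 0)%:R
        * (x ^+ (d - j.*2) * y ^+ j)
    = x ^+ (d - (s + m).*2) * y ^+ s * (1 + y ^+ m.*2).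
  have lesd : (s <= d./2.+1)%N by lia.
  rewrite -(big_mkord xpredT (fun j => (if (s <= j)%N then lucas m.*2 (j - s) else 0)%:R
        * (x ^+ (d - j.*2) * y ^+ j))) (big_cat_nat (leq0n s) lesd) //=.
  rewrite big_nat big1 ?add0r; last first.
    by move=> j /andP[_ ltjs]; rewrite leqNgt ltjs mul0r.
  have -> : y ^+ m.*2 = (- y) ^+ m.*2 by rewrite exprNn -signr_odd odd_double expr0 mul1r.
  rewrite -(@lucas_eval x y m.*2 (d./2.+1 - s)) //; last by lia.
  rewrite -{1}[s]add0n big_addn big_mkord mulr_sumr; apply: eq_bigr => i _.
  rewrite leq_addl addnK; have [im|mi] := leqP i m.
    have -> : (d - (i + s).*2 = (d - (s + m).*2) + (m.*2 - i.*2))%N by lia.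
    by rewrite !exprD; ring.
  by rewrite lucas_out ?ltn_double // !mul0r mulr0.
rewrite lucas_eval ?half_lt // exprNn -signr_odd odd_d expr0 expr1 exprD; ring.
Qed.

Lemma traded_H2d : in_H2d d (of_terms traded).
Proof.
have dE := odd_double_half d; rewrite odd_d in dE.
apply: (of_terms_H2d (t := (1, (0%N, d)))) => //=; last exact: traded_eval.
  move=> t; rewrite !inE => /or4P[/eqP->|/eqP->|/eqP->|/mapP[j jr ->]].
  - by rewrite /= ler01.
  - by split; [exact: ltW | rewrite /=; lia].
  - by split; [exact: ltW | rewrite /=; lia].
  - split; first exact: traded_coef_ge0.
    by have := mem_rem (mem_rem jr); rewrite mem_iota /=; lia.
by rewrite inE eqxx.
Qed.

Lemma traded_nterms : (2 * nterms (of_terms traded) <= d + 3)%N.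
Proof.
have dE := odd_double_half d; rewrite odd_d in dE.
have := of_terms_nterms traded; rewrite /traded /traded_terms size_cat size_map.
rewrite (size_rem traded_mem2) (size_rem traded_mem1) size_iota /=; lia.
Qed.

Lemma trade_not_unique : ~ uniqueness R d.
Proof.
have dE := odd_double_half d; rewrite odd_d in dE.
(* Both new monomials miss the line a + 2b = d of the Lucas terms. The flips of the two cannot both
   lie on it, so one whose flip does not is chosen. *)
pose b := if (s + (d - (s + m).*2).*2 == d)%N then (s + m.*2)%N else s.
have bP : b = s \/ b = (s + m.*2)%N by rewrite /b; case: ifP; [right | left].
have bd : (b + (d - (s + m).*2).*2 != d)%N.
  by rewrite /b; case: ifP => [/eqP E|-> //]; apply/eqP; lia.
apply: (@not_unique R d (of_terms (sharp_terms d)) (of_terms traded) (d - (s + m).*2) b).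
- by lia.
- exact: sharp_H2d.
- exact: traded_H2d.
- by have := sharp_nterms odd_d; lia.
- by have := traded_nterms; lia.
- have traded_ge0 t : t \in traded -> 0 <= t.1.
    rewrite !inE => /or4P[/eqP->|/eqP->|/eqP->|/mapP[j _ ->]]; try exact: ltW.
    exact: traded_coef_ge0.
  have tb : (lam, (d - (s + m).*2, b)%N) \in traded.
    by case: bP => ->; rewrite !inE eqxx ?orbT.
  exact: lt0r_neq0 (of_terms_coef_gt0 traded_ge0 tb _).
- by apply: sharp_coef0; [rewrite xpair_eqE negb_and; lia | case: bP => ->; lia].
- by apply: sharp_coef0; [rewrite xpair_eqE negb_and; case: bP => ->; lia | lia].
Qed.

End Trade.

End Failure.

(** * Degrees where uniqueness fails *)

Lemma lucas_1 n : lucas n.+2 1 = n.+2.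
Proof. by elim: n => // n IHn; rewrite lucasSS IHn lucas_0 addn1. Qed.

Lemma lucas_2 n : (lucas n.+4 2).*2 = (n.+4 * n.+1)%N.
Proof.
have := @lucas_ratio n.+4 1 isT; rewrite lucas_1 !subSS subn0 /=.
move: (lucas _ 2) => K; nia.
Qed.

(** There is equality at i = 0, and then the ratio v/u of consecutive coefficients on the right is
    at least the ratio v'/u' on the left. *)
Lemma lucas_dominates k i : (0 < k)%N -> (i <= k)%N ->
  ((4 * k + 3) * lucas k.*2 i <= lucas (4 * k + 3) i.+1)%N.
Proof.
move=> k_gt0; elim: i => [|i IHi] ik.
  have -> : (k.*2 = (k.*2.-1).+1)%N by lia.
  have -> : (4 * k + 3 = (4 * k + 1).+2)%N by lia.
  by rewrite lucas_0 lucas_1; lia.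
have {}IHi := IHi (ltnW ik).
have [t kE] : exists t, k = (i + t.+1)%N by exists (k - i.+1)%N; lia.
have := @lucas_ratio (4 * k + 3) i.+1; have := @lucas_ratio k.*2 i.
have -> : (k.*2 - i.+1 = i + 2 * t + 1)%N by lia.
have -> : (k.*2 - i.*2 = (2 * t + 1).+1)%N by lia.
have -> : (4 * k + 3 - i.+2 = 3 * i + 4 * t + 5)%N by lia.
have -> : (4 * k + 3 - (i.+1).*2 = (2 * i + 4 * t + 4).+1)%N by lia.
move=> /(_ ltac:(lia)) + /(_ ltac:(lia)) /=.
move: IHi; move: (lucas _ i) (lucas _ i.+1) (lucas _ i.+1) (lucas _ i.+2).
move=> c0 c1 K0 K1 le0 ec eK.
pose u := (i.+2 * (3 * i + 4 * t + 5))%N; pose u' := (i.+1 * (i + 2 * t + 1))%N.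
pose v := ((2 * i + 4 * t + 4).+1 * (2 * i + 4 * t + 4))%N.
pose v' := ((2 * t + 1).+1 * (2 * t + 1))%N.
have uv : (v' * u <= v * u')%N by rewrite /u /u' /v /v'; nia.
have u_gt0 : (0 < u)%N by rewrite /u; lia.
have u'_gt0 : (0 < u')%N by rewrite /u'; lia.
rewrite -(leq_pmul2r u_gt0) -(leq_pmul2r u'_gt0).
have {}eK : (K1 * u = v * K0)%N := eK.
have {}ec : (c1 * u' = v' * c0)%N := ec.
have -> : (K1 * u * u' = v * u' * K0)%N by rewrite eK; ring.
have -> : ((4 * k + 3) * c1 * u * u' = v' * u * ((4 * k + 3) * c0))%N.
  rewrite (_ : _ * _ * u * u' = (4 * k + 3) * u * (c1 * u'))%N; last by ring.
  by rewrite ec; ring.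
exact: leq_mul.
Qed.

Section Failures.
Variable R : realType.

Lemma not_unique_3_mod_4 d : (d = 3 %[mod 4])%N -> (7 <= d)%N -> ~ uniqueness R d.
Proof.
move=> d4 d7; have [k dE k_gt0] : exists2 k, d = (4 * k + 3)%N & (0 < k)%N.
  by exists (d %/ 4)%N; lia.
(* With d = 4k + 3 the coefficients d and d(d-3)/2 = d * 2k are d times the first two of u^(2k) +
   v^(2k). *)
apply: (@trade_not_unique R d 1 k 0 1 d%:R) => //; first by lia.
- by lia.
- by rewrite ltr0n; lia.
- by move=> i ik; rewrite -natrM ler_nat add1n dE lucas_dominates.
- rewrite -natrM; congr (_%:R).
  have -> : (k.*2 = (k.*2.-1).+1)%N by lia.
  by rewrite lucas_0 muln1 (_ : d = d.-2.+2) ?lucas_1 //; lia.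
- rewrite -natrM; congr (_%:R); apply: double_inj.
  have -> : (d = (d - 4).+4)%N by lia.
  rewrite lucas_2; have -> : (k.*2 = (k.*2.-2).+2)%N by lia.
  by rewrite lucas_1; nia.
Qed.

(** The trade uses u^4 + v^4, with coefficients 1, 4, 2. For d = 6t + 7 the coefficients at 2t+2 and
    2t+3 are in the ratio 4 : 2, and the one before is large enough. *)
Lemma not_unique_1_mod_6 d : (1 < d)%N -> (d = 1 %[mod 6])%N -> ~ uniqueness R d.
Proof.
move=> d_gt1 d6; have [t dE] : exists t, d = (6 * t + 7)%N by exists (d %/ 6 - 1)%N; lia.
have r1 := @lucas_ratio d (2 * t + 2); have r2 := @lucas_ratio d (2 * t + 1).
have {r1}E1 : (2 * lucas d (2 * t + 3) = lucas d (2 * t + 2))%N.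
  move: r1 => /(_ ltac:(lia)).
  rewrite (_ : (2 * t + 2).+1 = 2 * t + 3)%N; last by lia.
  rewrite (_ : d - (2 * t + 3) = 4 * t + 4)%N; last by lia.
  rewrite (_ : d - (2 * t + 2).*2 = (2 * t + 2).+1)%N; last by lia.
  move: (lucas d _) (lucas d _) => K2 K1 /= E; nia.
have {r2}E2 : (lucas d (2 * t + 2) <= 4 * lucas d (2 * t + 1))%N.
  move: r2 => /(_ ltac:(lia)).
  rewrite (_ : (2 * t + 1).+1 = 2 * t + 2)%N; last by lia.
  rewrite (_ : d - (2 * t + 2) = 4 * t + 5)%N; last by lia.
  rewrite (_ : d - (2 * t + 1).*2 = (2 * t + 4).+1)%N; last by lia.
  move: (lucas d _) (lucas d _) => K1 K0 /= E; nia.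
have K_gt0 : (0 < lucas d (2 * t + 2))%N by apply: lucas_gt0; lia.
apply: (@trade_not_unique R d (2 * t + 1) 2 1 2 ((lucas d (2 * t + 2))%:R / 4)) => //.
- by lia.
- by lia.
- by lia.
- by rewrite divr_gt0 // ltr0n.
- case=> [|[|[|//]]] _ /=.
  + rewrite addn0 mulr1 ler_pdivrMr // -natrM ler_nat; lia.
  + by rewrite divfK ?pnatr_eq0 // ler_nat -addnA leqnn.
  + by rewrite -addnA -E1 natrM (_ : lucas 4 2 = 2%N) //; lra.
- by rewrite divfK ?pnatr_eq0 // -addnA.
- by rewrite -addnA -E1 natrM (_ : lucas 4 2 = 2%N) //; lra.
Qed.

(** The trade uses u^2 + v^2 = x^2 + 2y and needs consecutive coefficients in the ratio 1 : 2. With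
    d = 2r + 1, m = 2n and s = r - n this reads r^2 + r = 3n^2, which is the Pell equation. *)
Lemma not_unique_pell_eq d m : (d ^ 2 = 3 * m ^ 2 + 1)%N -> (d %% 4 = 1)%N -> ~~ odd m ->
  (0 < m)%N -> ~ uniqueness R d.
Proof.
move=> pell d4 even_m m_gt0; have [n mE] : exists n, m = n.*2 by exists m./2; lia.
have [r dE] : exists r, d = (r.*2).+1 by exists d./2; lia.
have nr : (n.+1 <= r)%N by nia.
pose s := (r - n)%N; have rE : r = (s + n)%N by rewrite /s; lia.
have r1 := @lucas_ratio d s.
have {r1}E1 : (lucas d s.+1 = 2 * lucas d s)%N.
  move: r1 => /(_ ltac:(lia)).
  rewrite (_ : d - s.+1 = s + n.*2)%N; last by lia.
  rewrite (_ : d - s.*2 = (n.*2).+1)%N; last by lia.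
  move: (lucas d _) (lucas d _) => K1 K0 /= E.
  have pell' : ((n.*2).+1 * n.*2 = 2 * (s.+1 * (s + n.*2)))%N by nia.
  rewrite pell' in E; have : (0 < s.+1 * (s + n.*2))%N by lia.
  by move: (s.+1 * _)%N E => c; nia.
have K_gt0 : (0 < lucas d s)%N by apply: lucas_gt0; lia.
apply: (@trade_not_unique R d s 1 0 1 (lucas d s)%:R) => //.
- by lia.
- by lia.
- by lia.
- by rewrite ltr0n.
- case=> [|[|//]] _; rewrite -natrM ler_nat.
    by rewrite addn0 (_ : lucas _ 0 = 1%N) // muln1.
  by rewrite addn1 E1 (_ : lucas _ 1 = 2%N) // mulnC.
- by rewrite mulr1 addn0.
- by rewrite addn1 E1 mulnC natrM.
Qed.

Lemma pell_powers k : exists a b : nat,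
  [/\ (7 + 4 * Num.sqrt 3) ^+ (2 * k) = a%:R + b%:R * Num.sqrt 3 :> R,
      (7 - 4 * Num.sqrt 3) ^+ (2 * k) = a%:R - b%:R * Num.sqrt 3 :> R,
      (a ^ 2 = 3 * b ^ 2 + 1)%N, (a %% 4 = 1)%N
    & ~~ odd b /\ ((0 < k) ==> (0 < b))%N].
Proof.
have sqrt3 : Num.sqrt 3 ^+ 2 = 3 :> R by rewrite sqr_sqrtr ?ler0n.
elim: k => [|k [a [b [Ep Em E1 a4 [even_b _]]]]].
  by exists 1%N, 0%N; split; rewrite // ?muln0 ?expr0 ?mul0r ?addr0 ?subr0.
have aE : (97 * a + 168 * b)%:R = 97 * a%:R + 168 * b%:R :> R by rewrite natrD !natrM.
have bE : (56 * a + 97 * b)%:R = 56 * a%:R + 97 * b%:R :> R by rewrite natrD !natrM.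
(* Multiplication by (7 + 4 sqrt 3)^2 = 97 + 56 sqrt 3, of norm 1; since 97 is 1 mod 4 and 56, 168
   are multiples of 4, the residues persist. *)
exists (97 * a + 168 * b)%N, (56 * a + 97 * b)%N; rewrite aE bE; split.
- rewrite (_ : (2 * k.+1 = 2 + 2 * k)%N); last by lia.
  rewrite exprD Ep.
  move: (Num.sqrt 3) sqrt3 => r; rewrite expr2 => rr.
  transitivity (97 * a%:R + 56 * (r * r) * b%:R + (56 * a%:R + 97 * b%:R) * r
    + (r * r - 3) * (16 * a%:R + 16 * r * b%:R) : R); first by ring.
  by rewrite rr subrr mul0r addr0; ring.
- rewrite (_ : (2 * k.+1 = 2 + 2 * k)%N); last by lia.
  rewrite exprD Em.
  move: (Num.sqrt 3) sqrt3 => r; rewrite expr2 => rr.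
  transitivity (97 * a%:R + 56 * (r * r) * b%:R - (56 * a%:R + 97 * b%:R) * r
    + (r * r - 3) * (16 * a%:R - 16 * r * b%:R) : R); first by ring.
  by rewrite rr subrr mul0r addr0; ring.
- nia.
- lia.
- split; [lia | nia].
Qed.

Lemma not_unique_pell d k : (0 < k)%N ->
  d%:R = ((7 + 4 * Num.sqrt 3) ^+ (2 * k) + (7 - 4 * Num.sqrt 3) ^+ (2 * k)) / 2 :> R ->
  ~ uniqueness R d.
Proof.
move=> k_gt0 dE; have [a [b [Ep Em E1 a4 [even_b b_gt0]]]] := pell_powers k.
have {dE} -> : d = a.
  by apply/eqP; rewrite -(eqr_nat R) dE Ep Em; apply/eqP; field.
by apply: (not_unique_pell_eq E1 a4 even_b); move: b_gt0; rewrite k_gt0.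
Qed.

(** The sharp polynomial of degree [e] with x^e replaced by x^e (x + y). *)
Definition x_tensored (e : nat) : seq (R * (nat * nat)) :=
  [:: (1, (0%N, e)); (1, (e.+1, 0%N)); (1, (e, 1%N))] ++ behead (lucas_terms R e).

(** y + x S, with S the sharp polynomial of degree [e]. *)
Definition x_multiplied (e : nat) : seq (R * (nat * nat)) :=
  (1, (0%N, 1%N)) :: [seq (t.1, (t.2.1.+1, t.2.2)) | t <- sharp_terms R e].

Lemma lucas_terms_cons e : (0 < e)%N ->
  lucas_terms R e = (1, (e, 0%N)) :: behead (lucas_terms R e).
Proof. by case: e => // e _; rewrite /lucas_terms /= lucas_0 subn0. Qed.

Lemma mem_lucas_terms e t : t \in lucas_terms R e ->
  [/\ 0 <= t.1, (t.2.2 <= e./2)%N & t.2.1 = (e - t.2.2.*2)%N].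
Proof. by case/mapP => j; rewrite mem_iota /= => je ->; split; rewrite ?ler0n. Qed.

Lemma mem_behead_lucas_terms e t : t \in behead (lucas_terms R e) ->
  [/\ 0 <= t.1, (0 < t.2.2 <= e./2)%N & t.2.1 = (e - t.2.2.*2)%N].
Proof.
by case/mapP => j; rewrite mem_iota /= => je ->; split; rewrite ?ler0n //; lia.
Qed.

(** Both constructions raise the degree by one at the cost of one term. Only the second contains y,
    and the first has no monomial of degree one. *)
Lemma not_unique_even_ge4 e : odd e -> (3 <= e)%N -> ~ uniqueness R e.+1.
Proof.
move=> odd_e e3; have e_gt0 : (0 < e)%N by lia.
have eE := odd_double_half e; rewrite odd_e in eE.
have evalL (x y : R) : x + y = 1 ->
    \sum_(u <- behead (lucas_terms R e)) u.1 * (x ^+ u.2.1 * y ^+ u.2.2) = 1 - y ^+ e - x ^+ e.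
  move=> /(lucas_terms_eval e); rewrite lucas_terms_cons // big_cons /= !expr0 exprNn.
  by rewrite -signr_odd odd_e expr1; lra.
have low_coef0 a b : (a + b = 1)%N -> (of_terms (x_tensored e))@_(mxy a b) = 0.
  move=> ab; apply: of_terms_coef_out; apply/negP => /mapP[t tL tE].
  have [aE bE] : a = t.2.1 /\ b = t.2.2 by rewrite -tE.
  move: aE bE; move: tL; rewrite !inE.
  case/or4P => [/eqP->|/eqP->|/eqP->|/mem_behead_lucas_terms[_ ]] /=.
  - by move=> aE bE; lia.
  - by move=> aE bE; lia.
  - by move=> aE bE; lia.
  - by move: t.2.1 t.2.2 => u v v_le uE aE bE; lia.
apply: (@not_unique R e.+1 (of_terms (x_tensored e)) (of_terms (x_multiplied e)) 0 1) => //.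
- apply: (of_terms_H2d (t := (1, (e.+1, 0%N)))) => //=.
  + move=> t; rewrite !inE => /or4P[/eqP->|/eqP->|/eqP->|/mem_behead_lucas_terms[t0 t2 t1]].
    * by rewrite ler01.
    * by rewrite ler01 addn0.
    * by rewrite ler01 addn1.
    * by split=> //; move: t.2.1 t.2.2 t1 t2 => a b; lia.
  + by rewrite !inE eqxx orbT.
  + by rewrite addn0.
  + move=> x y xy; rewrite !big_cons /= evalL // !expr0 expr1 exprS.
    by rewrite (_ : y = 1 - x); [ring | lra].
- apply: (of_terms_H2d (t := (1, (1%N, e)))) => //=.
  + move=> t; rewrite inE => /predU1P[->|/mapP[u]]; first by rewrite ler01.
    rewrite inE => /predU1P[-> -> /=|/mem_lucas_terms[u0 u2 u1] -> /=].
      by rewrite ler01 add1n.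
    by split=> //=; move: u.2.1 u.2.2 u1 u2 => a b; lia.
  + by rewrite !inE eqxx orbT.
  + move=> x y xy; rewrite big_cons big_map big_cons /=.
    under eq_bigr => u _ do rewrite exprS -mulrA mulrCA.
    rewrite -mulr_sumr lucas_terms_eval // exprNn -signr_odd odd_e !expr0 !expr1.
    by rewrite (_ : y = 1 - x); [ring | lra].
- have := of_terms_nterms (x_tensored e); rewrite size_cat size_behead size_map size_iota /=; lia.
- have := of_terms_nterms (x_multiplied e); rewrite /= !size_map size_iota; lia.
- apply: lt0r_neq0; apply: (of_terms_coef_gt0 (t := (1, (0%N, 1%N)))) => //.
    move=> t; rewrite inE => /predU1P[->|/mapP[u]]; first by rewrite ler01.
    by rewrite inE => /predU1P[-> -> /=|/mem_lucas_terms[u0 _ _] -> /=].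
  by rewrite inE eqxx.
- exact: low_coef0.
- exact: low_coef0.
Qed.

(** For e = 1 the two constructions coincide; (x + y)^2 and x(x + y) + y serve instead. *)
Lemma not_unique_2 : ~ uniqueness R 2.
Proof.
pose f : seq (R * (nat * nat)) := [:: (1, (2, 0)%N); (2, (1, 1)%N); (1, (0, 2)%N)].
pose g : seq (R * (nat * nat)) := [:: (1, (2, 0)%N); (1, (1, 1)%N); (1, (0, 1)%N)].
apply: (@not_unique R 2 (of_terms f) (of_terms g) 0 1) => //.
- apply: (of_terms_H2d (t := (1, (2, 0)%N))) => //=.
  + by move=> t; rewrite !inE => /or3P[] /eqP->; rewrite ?ler01 ?ler0n.
  + by rewrite !inE eqxx.
  + move=> x y xy; rewrite !big_cons big_nil /= !expr0 !expr1 (_ : y = 1 - x); [ring | lra].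
- apply: (of_terms_H2d (t := (1, (2, 0)%N))) => //=.
  + by move=> t; rewrite !inE => /or3P[] /eqP->; rewrite ?ler01 ?ler0n.
  + by rewrite !inE eqxx.
  + move=> x y xy; rewrite !big_cons big_nil /= !expr0 !expr1 (_ : y = 1 - x); [ring | lra].
- by have := of_terms_nterms f; rewrite /=; lia.
- by have := of_terms_nterms g; rewrite /=; lia.
- apply: lt0r_neq0; apply: (of_terms_coef_gt0 (t := (1, (0, 1)%N))) => //.
    by move=> t; rewrite !inE => /or3P[] /eqP->; rewrite ?ler01.
  by rewrite !inE eqxx !orbT.
- exact: of_terms_coef_out.
- exact: of_terms_coef_out.
Qed.

Lemma not_unique_even d : (2 <= d)%N -> ~~ odd d -> ~ uniqueness R d.
Proof.
case: d => [|[|[|d]]] // _; first by move=> _; exact: not_unique_2.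
by rewrite /= negbK => odd_d; apply: not_unique_even_ge4 => //=; case: d odd_d.
Qed.

End Failures.

(** * Exhaustive elimination *)

Definition point : Type := (nat * nat)%type.

Definition interior (d : nat) : seq point :=
  [seq x <- allpairs pair (iota 1 d) (iota 1 d) | (x.1 + x.2 <= d)%N].

(* Alternating between both ends keeps few points with a nonzero entry at the pivot. *)
Fixpoint coordinates (n k : nat) (d : nat) : seq nat :=
  if n is m.+1 then k :: (d - k)%N :: coordinates m k.+1 d else [::].

(** The coefficient of ['X^k] in (1 + 'X)^(d-a-b) 'X^b, which is x^a y^b homogenised by x + y, at x
    = 1. *)
Definition weight (d : nat) (x : point) (k : nat) : nat :=
  if (x.2 <= k)%N then 'C(d - (x.1 + x.2), k - x.2) else 0.

Definition weights (d : nat) (x : point) : seq Z :=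
  [seq Z.of_nat (weight d x k) | k <- coordinates d./2 1 d].

Definition target (d : nat) : seq Z :=
  [seq Z.of_nat 'C(d, k) | k <- coordinates d./2 1 d].

(** Fraction-free elimination of entry [k] of [w] by means of [v]. *)
Definition cross (k : nat) (v w : seq Z) : seq Z :=
  let vk := nth Z0 v k in let wk := nth Z0 w k in
  [seq Z.sub (Z.mul vk x.1) (Z.mul wk x.2) | x <- zip w v].

Definition pivot (v : seq Z) : nat := find (fun z => ~~ Z.eqb z Z0) v.

(** Eliminating all vectors but the last turns the relation into g = c v, and a negative product of
    pivot entries means c < 0. *)
Fixpoint infeasible (n : nat) (g : seq Z) (vs : seq (seq Z)) : bool :=
  if vs is v :: vs' then
    let k := pivot v in
    if n is m.+1 then infeasible m (cross k v g) [seq cross k v w | w <- vs']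
    else nilp vs' && Z.ltb (Z.mul (nth Z0 v k) (nth Z0 g k)) Z0
  else false.

(* Only the sign of the last coefficient is tested, whence the rotations. *)
Definition refuted (d : nat) (s : seq point) : bool :=
  has (fun i => infeasible (size s).-1 (target d) [seq weights d x | x <- rot i s])
    (iota 0 (size s)).

(* Some remaining point must have a nonzero entry at the pivot of [g]; branch on it.
   A target that vanishes too early makes the search fail. *)
Fixpoint search (ok : seq point -> bool) (fuel : nat) (g : seq Z)
    (cands : seq (point * seq Z)) (chosen : seq point) : bool :=
  let k := pivot g in
  if (k < size g)%N then
    if fuel is f.+1 then
      all (fun c => if Z.eqb (nth Z0 c.2 k) Z0 then true else
        search ok f (cross k c.2 g)
          (if f is 0 then [::] else
            [seq (w.1, cross k c.2 w.2) | w <- cands & w.1 != c.1])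
          (c.1 :: chosen)) cands
    else true
  else (fuel == 0%N) && ok chosen.

Definition lucas_support (d : nat) : seq point :=
  [seq (d - j.*2, j)%N | j <- iota 1 d./2].

Definition flip (x : point) : point := (x.2, x.1).

Definition only_lucas (d : nat) : bool :=
  search (fun s => [|| perm_eq s (lucas_support d),
                      perm_eq s (map flip (lucas_support d)) | refuted d s])
    d./2 (target d) [seq (x, weights d x) | x <- interior d] [::].

(** * Soundness of the elimination over the reals *)

Section SearchSound.
Variable R : realType.

Definition zR (z : Z) : R := (int_of_Z z)%:~R.

Lemma zRB a b : zR (Z.sub a b) = zR a - zR b.
Proof. by rewrite /zR -[Z.sub a b]/(a - b) rmorphB rmorphB. Qed.

Lemma zRM a b : zR (Z.mul a b) = zR a * zR b.
Proof. by rewrite /zR -[Z.mul a b]/(a * b) rmorphM rmorphM. Qed.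

Lemma zR0 : zR Z0 = 0. Proof. by []. Qed.

Lemma zR_nat n : zR (Z.of_nat n) = n%:R.
Proof. by rewrite /zR -[Z.of_nat n]/(Z.of_nat (id n)) -[in LHS](natn n) !rmorph_nat. Qed.

Lemma zR_eq0 z : (zR z == 0) = Z.eqb z Z0.
Proof. by rewrite /zR intr_eq0 -[0 : int]/(int_of_Z Z0) (inj_eq (can_inj int_of_ZK)). Qed.

Lemma zR_lt0 z : Z.ltb z Z0 -> zR z < 0.
Proof. by move=> z0; rewrite /zR ltrz0; lia. Qed.

Definition entry (v : seq Z) (k : nat) : R := zR (nth Z0 v k).

Lemma size_cross k v w : size v = size w -> size (cross k v w) = size w.
Proof. by move=> E; rewrite size_map size_zip E minnn. Qed.

Lemma entry_cross k v w j : size v = size w ->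
  entry (cross k v w) j = entry v k * entry w j - entry w k * entry v j.
Proof.
move=> E; rewrite /entry; have [jw|wj] := ltnP j (size w).
  rewrite (nth_map (Z0, Z0)) ?size_zip ?E ?minnn // nth_zip //=.
  by rewrite zRB !zRM.
have vj : (size v <= j)%N by rewrite E.
have cj : (size (cross k v w) <= j)%N by rewrite size_cross.
by rewrite (nth_default _ cj) (nth_default _ vj) (nth_default _ wj) zR0 !mulr0 subr0.
Qed.

Lemma pivot_lt v : (pivot v < size v)%N -> entry v (pivot v) != 0.
Proof. by rewrite -has_find => /(nth_find Z0) /=; rewrite /entry zR_eq0. Qed.

Definition combination (V : point -> seq Z) (c : point -> R) (s : seq point) (g : seq Z) : Prop :=
  forall k, entry g k = \sum_(x <- s) c x * entry (V x) k.

(** Crossing with V x is linear and kills V x itself, so x drops out while the other coefficients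
    stay the same. *)
Lemma combination_cross V c s g x k :
  (forall y, size (V y) = size g) -> uniq s -> x \in s -> combination V c s g ->
  combination (fun y => cross k (V x) (V y)) c (rem x s) (cross k (V x) g).
Proof.
move=> sV us xs gE j; rewrite entry_cross ?sV //.
have split_x i : entry g i = c x * entry (V x) i + \sum_(y <- rem x s) c y * entry (V y) i.
  by rewrite gE (big_rem x xs).
rewrite !split_x.
rewrite mulrDr mulrDl mulr_sumr mulr_suml.
rewrite [in RHS](eq_bigr (fun y => entry (V x) k * (c y * entry (V y) j)
    - c y * entry (V y) k * entry (V x) j)); last first.
  by move=> y _; rewrite entry_cross ?sV //; ring.
rewrite sumrB; ring.
Qed.

Lemma search_sound ok fuel V c s g cands chosen :
  (forall x, size (V x) = size g) -> (forall w, w \in cands -> w.2 = V w.1) ->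
  uniq s -> (size s <= fuel)%N ->
  {subset s <= [seq w.1 | w <- cands]} -> combination V c s g ->
  search ok fuel g cands chosen -> exists2 s', perm_eq s' (s ++ chosen) & ok s'.
Proof.
elim: fuel V s g cands chosen => [|f IHf] V s g cands chosen sV cV us.
  rewrite leqn0 size_eq0 => /eqP-> _ g0 /=.
  case: ifP => [/pivot_lt|_ ok_chosen]; last by exists chosen.
  by rewrite g0 big_nil eqxx.
move=> sf sub gE /=; case: ifP => [pg|_]; last by [].
move/allP=> found.
have [x xs Vx] : exists2 x, x \in s & entry (V x) (pivot g) != 0.
  apply/hasP; apply: contraT; rewrite -all_predC => /allP V0.
  have := pivot_lt pg; rewrite gE big_seq big1 ?eqxx // => x /V0 /=.
  by rewrite negbK => /eqP->; rewrite mulr0.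
have /mapP[w wc xw] := sub x xs.
have wV := cV w wc; rewrite -xw in wV.
have := found w wc; rewrite wV -zR_eq0 (negbTE Vx) -xw => searched.
have srem : (size (rem x s) <= f)%N by rewrite size_rem //; lia.
have [|||||s' perm_s' ok_s']
  := IHf (fun y => cross (pivot g) (V x) (V y)) (rem x s) _ _ _ _ _ _ srem _ _ searched.
- by move=> y; rewrite !size_cross ?sV.
- case: (f) => [//|f'] u /mapP[u0]; rewrite mem_filter => /andP[_ /cV u0V] -> /=.
  by rewrite u0V.
- exact: rem_uniq.
(* The candidate list is emptied when the fuel runs out, but then no point of [s] remains either. *)
- move=> y ys; have : (0 < f)%N by apply: leq_trans srem; case: (rem x s) ys.
  case: (f) => // f' _; rewrite -map_comp.
  have := ys; rewrite mem_rem_uniq // inE => /andP[nyx /sub/mapP[u uc yu]].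
  by apply/mapP; exists u => //; rewrite mem_filter uc -yu nyx.
- exact: combination_cross.
exists s' => //; apply: perm_trans perm_s' _.
rewrite -cat1s catA perm_cat2r perm_sym.
by apply: perm_trans (perm_to_rem xs) _; rewrite -cat1s perm_catC.
Qed.

Lemma infeasible_sound n V c s g : (forall x, size (V x) = size g) ->
  uniq s -> (forall x, x \in s -> 0 < c x) -> combination V c s g ->
  infeasible n g (map V s) = false.
Proof.
elim: n V s g => [|n IHn] V [|x s] g sV //= /andP[xs us] c_gt0 gE.
  case: s xs us c_gt0 gE => // xs us c_gt0 gE /=; apply/negP => /zR_lt0.
  rewrite zRM -/(entry _ _) -/(entry _ _) gE big_seq1 mulrCA -expr2.
  by rewrite ltNge mulr_ge0 ?sqr_ge0 // ltW // c_gt0 ?mem_head.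
rewrite -map_comp.
apply: (IHn (fun y => cross (pivot (V x)) (V x) (V y))).
- by move=> y; rewrite !size_cross ?sV.
- by [].
- by move=> y ys; apply: c_gt0; rewrite inE ys orbT.
have := combination_cross (pivot (V x)) sV _ (mem_head x s) gE.
by rewrite /= eqxx; apply; rewrite xs.
Qed.

End SearchSound.

(** * Sharp polynomials in degrees 1, 3, 5 and 9 *)

Lemma mem_interior d a b :
  ((a, b) \in interior d) = [&& (0 < a)%N, (0 < b)%N & (a + b <= d)%N].
Proof.
rewrite mem_filter /=; apply/andP/and3P => [[abd /allpairsP[[a' b'] /= []]]|[a0 b0 abd]].
  by rewrite !mem_iota => /andP[a0 _] /andP[b0 _] [aE bE]; subst a b; split.
split=> //; apply/allpairsP; exists (a, b); split; rewrite //= mem_iota; lia.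
Qed.

Lemma interior_uniq d : uniq (interior d).
Proof.
apply/filter_uniq/allpairs_uniq; rewrite ?iota_uniq // => -[a b] [a' b'] _ _ /= [-> ->].
by [].
Qed.

Lemma coordinates_bound n k d j : (0 < k)%N -> (n + k <= d)%N ->
  j \in coordinates n k d -> (0 < j < d)%N.
Proof.
elim: n k => // n IHn k k0 nkd /=; rewrite !inE => /or3P[/eqP->|/eqP->|]; try lia.
by apply: IHn; lia.
Qed.

Section Sharp.
Variable R : realType.
Implicit Types (p f g : {mpoly R[2]}) (x : point).

Definition coef p x : R := p@_(mxy x.1 x.2).

(** Comparison of the coefficients of ['X^k] in p = 1, homogenised by x + y and taken at x = 1. *)
Lemma H2d_weights p d k : in_H2d d p ->
  'C(d, k)%:R = \sum_(m <- msupp p) p@_m * (weight d (m 0%R, m 1%R) k)%:R :> R.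
Proof.
move=> [[_ p1] sp].
pose w (m : 'X_{1..2}) : {poly R} := (1 + 'X) ^+ (d - mdeg m) * 'X^(m 1%R).
have E : (1 + 'X) ^+ d - \sum_(m <- msupp p) p@_m *: w m = 0.
  apply: poly_eq0_on_nat => n; set t : R := n%:R.
  have t1 : 1 + t != 0 by rewrite lt0r_neq0 // ltr_wpDr // ler0n.
  pose v (i : 'I_2) : R := if i == 0 then (1 + t)^-1 else t / (1 + t).
  have v1 : v 0 + v 1 = 1 by rewrite /v /= -[X in X + _]mul1r -mulrDl divff.
  rewrite hornerD hornerN horner_sum horner_exp !hornerE.
  apply/eqP; rewrite subr_eq0; apply/eqP.
  transitivity ((1 + t) ^+ d * p.@[v]); first by rewrite p1 // mulr1.
  rewrite mevalE mulr_sumr [LHS]big_seq [RHS]big_seq; apply: eq_bigr => m mp.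
  have md : (mdeg m <= d)%N by rewrite -ltnS -sp msize_mdeg_lt.
  rewrite hornerZ /w hornerM horner_exp hornerXn !hornerE /= -!mulrA mulrCA; congr (_ * _).
  rewrite -mevalX {1}[m]mnm2E meval_mxy /v /= expr_div_n exprVn.
  have -> : (1 + t) ^+ d = (1 + t) ^+ (d - mdeg m) * ((1 + t) ^+ (m 0%R) * (1 + t) ^+ (m 1%R)).
    by rewrite -!exprD -mdeg2E subnK.
  have t0 := expf_neq0 (m 0%R) t1; have tb := expf_neq0 (m 1%R) t1.
  by field; rewrite t0 tb.
have binom n j : ((1 + 'X : {poly R}) ^+ n)`_j = 'C(n, j)%:R.
  elim: n j => [|n IHn] [|j]; rewrite ?expr0 ?coef1 ?bin0 //.
    by rewrite exprS mulrDl mul1r coefD coefXM IHn bin0 addr0.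
  by rewrite exprS mulrDl mul1r coefD coefXM !IHn binS natrD.
move/eqP: E; rewrite subr_eq0 => /eqP/(congr1 (fun f : {poly R} => f`_k)).
rewrite binom coef_sum => ->; apply: eq_bigr => m _.
rewrite coefZ /w coefMXn binom /weight /= -mdeg2E; case: ltnP => //.
Qed.

Lemma msupp_sum1 p (G : 'X_{1..2} -> R) m0 :
  (forall m, m \in msupp p -> m != m0 -> G m = 0) ->
  \sum_(m <- msupp p) p@_m * G m = p@_m0 * G m0.
Proof.
move=> G0; have [m0p|nm0p] := boolP (m0 \in msupp p).
  rewrite (bigD1_seq m0) ?msupp_uniq //= big_seq_cond big1 ?addr0 // => m /andP[mp nm].
  by rewrite G0 ?mulr0.
rewrite (memN_msupp_eq0 nm0p) mul0r big_seq big1 // => m mp.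
by rewrite G0 ?mulr0 //; apply: contraNneq nm0p => <-.
Qed.

Definition sharp p d : Prop :=
  [/\ odd d, in_H2d d p & (2 * nterms p <= d + 3)%N].

Lemma swap_swap p : swap (swap p) = p.
Proof. by apply/mpolyP => m; rewrite [m]mnm2E !swap_coef. Qed.

Lemma sharp_swap p d : sharp p d -> sharp (swap p) d.
Proof.
by move=> [odd_d Hp np]; split=> //; [exact: swap_H2d | have := nterms_swap_le p; lia].
Qed.

Section OneSharp.
Variables (p : {mpoly R[2]}) (d : nat).
Hypothesis sharp_p : sharp p d.

Lemma sharp_axis n : (n < d)%N -> p@_(mxy n 0) = 0 /\ p@_(mxy 0 n) = 0.
Proof.
case: sharp_p; case: d => // D /= evenD Hp np; rewrite ltnS => nD.
have np' : (2 * nterms p <= D + 4)%N by lia.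
have [p00 pb] := sharp_bottom evenD Hp np'; have pl := sharp_left evenD Hp np'.
by case: n nD => [|n] nD; rewrite ?p00 // pb ?pl.
Qed.

(** At k = 0 only pure powers of x have weight, and x^d is the only one left. *)
Lemma sharp_corner : p@_(mxy d 0) = 1.
Proof.
have [odd_d Hp _] := sharp_p; have [[_ p1] sp] := Hp.
have := H2d_weights 0 Hp; rewrite bin0 (msupp_sum1 (m0 := mxy d 0)).
  by rewrite mxyE0 mxyE1 /weight /= addn0 subnn bin0 mulr1 => <-.
move=> m mp nm; rewrite /weight /= leqn0; case: eqP => // m1.
have md : (mdeg m <= d)%N by rewrite -ltnS -sp msize_mdeg_lt.
case/negP: nm; move: mp; rewrite mcoeff_msupp [m]mnm2E m1 => pm.
rewrite mdeg2E m1 addn0 leq_eqVlt in md; case/predU1P: md => [->//|md].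
by have [pm0 _] := sharp_axis md; rewrite pm0 eqxx in pm.
Qed.
End OneSharp.

Definition support p d : seq point := [seq x <- interior d | coef p x != 0].

Section OneSharpSupport.
Variables (p : {mpoly R[2]}) (d : nat).
Hypothesis sharp_p : sharp p d.

Lemma sharp_corner' : p@_(mxy 0 d) = 1.
Proof. by rewrite -swap_coef (sharp_corner (sharp_swap sharp_p)). Qed.

Lemma support_uniq : uniq (support p d).
Proof. exact/filter_uniq/interior_uniq. Qed.

Lemma mem_support a b : ((a, b) \in support p d) =
  [&& p@_(mxy a b) != 0, (0 < a)%N, (0 < b)%N & (a + b <= d)%N].
Proof. by rewrite mem_filter mem_interior. Qed.

Lemma sharp_coef_out a b : p@_(mxy a b) != 0 ->
  [\/ (a, b) = (d, 0)%N, (a, b) = (0, d)%N | (a, b) \in support p d].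
Proof.
move=> pab; have [odd_d [_ sp] _] := sharp_p.
have abd : (a + b <= d)%N.
  by rewrite -mdeg_mxy -ltnS -sp msize_mdeg_lt // mcoeff_msupp.
case: a abd pab => [|a] abd pab.
  case: (ltnP b d) => [/(sharp_axis sharp_p)[_ p0]|db]; first by rewrite p0 eqxx in pab.
  by constructor 2; congr (_, _); lia.
case: b abd pab => [|b] abd pab; last by constructor 3; rewrite mem_support pab abd.
case: (ltnP a.+1 d) => [/(sharp_axis sharp_p)[p0 _]|db]; first by rewrite p0 eqxx in pab.
by constructor 1; congr (_, _); lia.
Qed.

Lemma sharp_weights k : (0 < k < d)%N ->
  'C(d, k)%:R = \sum_(x <- support p d) coef p x * (weight d x k)%:R :> R.
Proof.
move=> /andP[k_gt0 ltkd]; have [odd_d Hp _] := sharp_p; rewrite (H2d_weights k Hp).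
pose inner (m : 'X_{1..2}) := (m 0%R, m 1%R) \in support p d.
rewrite (bigID inner) /= [X in _ + X]big_seq_cond [X in _ + X]big1 ?addr0; last first.
  move=> m; rewrite mcoeff_msupp /inner {1}[m]mnm2E => /andP[/sharp_coef_out[]].
  - by case=> -> -> _; rewrite /weight /= addn0 subnn subn0 bin_small ?mulr0.
  - by case=> -> ->; rewrite /weight /= leqNgt ltkd mulr0.
  - by move->.
rewrite -big_filter.
have -> : \sum_(x <- support p d) coef p x * (weight d x k)%:R
    = \sum_(m <- [seq mxy x.1 x.2 | x <- support p d])
        p@_m * (weight d (m 0%R, m 1%R) k)%:R.
  by rewrite big_map; apply: eq_bigr => -[a b] _; rewrite mxyE0 mxyE1.
apply: perm_big; apply: uniq_perm.
- exact/filter_uniq/msupp_uniq.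
- rewrite map_inj_uniq ?support_uniq // => -[a b] [a' b'] /= /mxy_inj[-> ->] //.
move=> m; rewrite mem_filter {}/inner; apply/andP/mapP => [[ms mp]|[[a b] ab ->]].
  by exists (m 0%R, m 1%R) => //; exact: mnm2E.
split; first by rewrite mxyE0 mxyE1.
by move: ab; rewrite mem_support mcoeff_msupp => /and4P[].
Qed.

Lemma size_support : (size (support p d) <= d./2)%N.
Proof.
have [odd_d Hp np] := sharp_p; have dE := odd_double_half d; rewrite odd_d in dE.
have size_mon : size [seq mxy x.1 x.2 | x <- [:: (d, 0); (0, d)]%N ++ support p d]
  = (size (support p d)).+2 by rewrite size_map.
suff : (size [seq mxy x.1 x.2 | x <- [:: (d, 0); (0, d)]%N ++ support p d] <= nterms p)%N.
  by rewrite size_mon; lia.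
apply: uniq_leq_size.
  rewrite map_inj_uniq => [|[a b] [a' b'] /= /mxy_inj[-> ->] //].
  rewrite cat_uniq support_uniq andbT /= !inE !xpair_eqE; apply/andP; split.
    by lia.
  apply/hasPn => -[a b]; rewrite mem_support => /and4P[_ a0 b0 _].
  by rewrite !inE !xpair_eqE; lia.
move=> m /mapP[[a b]]; rewrite mem_cat !inE mcoeff_msupp => /orP[/orP[]/eqP[-> ->]|ab] ->.
- by rewrite /= (sharp_corner sharp_p) oner_neq0.
- by rewrite /= sharp_corner' oner_neq0.
- by move: ab; rewrite mem_support => /and4P[].
Qed.

Lemma support_combination :
  combination (weights d) (coef p) (support p d) (target d).
Proof.
have [odd_d _ _] := sharp_p; have dE := odd_double_half d; rewrite odd_d in dE.
move=> i; have [id|di] := ltnP i (size (coordinates d./2 1 d)); last first.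
  rewrite /entry nth_default ?size_map // big1 // => x _.
  by rewrite nth_default ?size_map // zR0 mulr0.
rewrite /entry (nth_map 0%N) // zR_nat sharp_weights.
  by apply: eq_bigr => x _; rewrite (nth_map 0%N) // zR_nat.
by apply: (coordinates_bound (n := d./2) (k := 1)); rewrite ?mem_nth //; lia.
Qed.

Lemma support_coef_gt0 x : x \in support p d -> 0 < coef p x.
Proof.
have [_ [[p_ge0 _] _] _] := sharp_p.
by rewrite mem_filter lt0r => /andP[-> _]; exact: p_ge0.
Qed.

Lemma refuted_support s : perm_eq s (support p d) -> ~~ refuted d s.
Proof.
move=> ps; apply/hasPn => i _; apply/negbT.
apply: (@infeasible_sound R _ (weights d) (coef p) (rot i s)).
- by move=> x; rewrite !size_map.
- by rewrite rot_uniq (perm_uniq ps) support_uniq.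
- by move=> x; rewrite mem_rot (perm_mem ps); exact: support_coef_gt0.
move=> k; rewrite support_combination; apply: perm_big.
by rewrite perm_sym perm_rot.
Qed.

Lemma only_lucas_support : only_lucas d ->
  perm_eq (support p d) (lucas_support d) \/
  perm_eq (support p d) (map flip (lucas_support d)).
Proof.
move=> only; have [|||s ps] := @search_sound R _ _ (weights d) (coef p) (support p d) _ _ _ _ _
  support_uniq size_support _ support_combination only.
- by move=> x; rewrite !size_map.
- by move=> w /mapP[x _ ->].
- by move=> x; rewrite -map_comp map_id_in // mem_filter => /andP[].
rewrite cats0 in ps; case/or3P => [sl|sl|sr].
- by left; rewrite perm_sym (perm_trans _ ps) // perm_sym.
- by right; rewrite perm_sym (perm_trans _ ps) // perm_sym.
- by have := refuted_support ps; rewrite sr.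
Qed.

End OneSharpSupport.

Lemma flipK : involutive flip. Proof. by case. Qed.

Lemma support_swap p d : perm_eq (support (swap p) d) (map flip (support p d)).
Proof.
apply: uniq_perm; first exact: support_uniq.
  by rewrite (map_inj_uniq (inv_inj flipK)) support_uniq.
move=> x; rewrite -[x]flipK (mem_map (inv_inj flipK)); case: x => b a.
rewrite /flip /= !mem_support swap_coef addnC; congr (_ && _).
by rewrite andbCA.
Qed.

Lemma lucas_support_inj d x y : x \in lucas_support d -> y \in lucas_support d ->
  x.2 = y.2 -> x = y.
Proof. by move=> /mapP[i _ ->] /mapP[j _ ->] /= ->. Qed.

(** Lucas points have distinct y-exponents; at coordinate b the point with exponent b has weight 1
    and those with larger exponent weight 0. This triangular system fixes the coefficients. *)
Lemma sharp_eq p p' d : sharp p d -> sharp p' d ->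
  perm_eq (support p d) (lucas_support d) -> perm_eq (support p' d) (lucas_support d) ->
  p = p'.
Proof.
move=> Hp Hp' sp sp'; have [odd_d _ _] := Hp.
have dE := odd_double_half d; rewrite odd_d in dE.
have uL : uniq (lucas_support d) by rewrite -(perm_uniq sp) support_uniq.
have eqL b x : x \in lucas_support d -> x.2 = b -> coef p x = coef p' x.
  elim/ltn_ind: b x => b IHb x xL xb.
  have bd : (0 < b < d)%N.
    by case/mapP: (xL) xb => j; rewrite mem_iota => jd -> /= <-; lia.
  have := sharp_weights Hp bd; rewrite (sharp_weights Hp' bd) (perm_big _ sp) (perm_big _ sp').
  rewrite /= !(bigD1_seq x xL uL) /= {1 3}/weight xb leqnn subnn bin0 !mulr1.
  have -> : \sum_(y <- lucas_support d | y != x) coef p y * (weight d y b)%:R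
      = \sum_(y <- lucas_support d | y != x) coef p' y * (weight d y b)%:R.
    rewrite big_seq_cond [RHS]big_seq_cond; apply: eq_bigr => y /andP[yL nyx].
    case: (ltngtP y.2 b) => [yb|by_|yb]; first by rewrite (IHb _ yb).
      by rewrite /weight leqNgt by_ /= !mulr0.
    by case/eqP: nyx; apply: lucas_support_inj yL xL _; rewrite yb xb.
  by move/addIr.
apply/mpolyP => m; rewrite [m]mnm2E; move: (m 0) (m 1) => a b {m}.
have [ab0|] := boolP ((p@_(mxy a b) == 0) && (p'@_(mxy a b) == 0)).
  by case/andP: ab0 => /eqP-> /eqP->.
rewrite negb_and => nz.
have : [\/ (a, b) = (d, 0)%N, (a, b) = (0, d)%N | (a, b) \in lucas_support d].
  by case/orP: nz => [/(sharp_coef_out Hp)|/(sharp_coef_out Hp')];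
    rewrite ?(perm_mem sp) ?(perm_mem sp').
case=> [[-> ->]|[-> ->]|abL].
- by rewrite (sharp_corner Hp) (sharp_corner Hp').
- by rewrite (sharp_corner' Hp) (sharp_corner' Hp').
- exact: (eqL b (a, b)).
Qed.

Lemma sharp_orient p d : sharp p d -> only_lucas d ->
  perm_eq (support p d) (lucas_support d) \/ perm_eq (support (swap p) d) (lucas_support d).
Proof.
move=> Hp /(only_lucas_support Hp)[|pf]; [by left | right].
apply: perm_trans (support_swap p d) _.
by rewrite -[X in perm_eq _ X](mapK flipK) perm_map.
Qed.

(** A minimal f is sharp, since the Lucas polynomial attains the bound. After a swap where
    necessary, f and g both have the Lucas support and so coincide. *)
Lemma only_lucas_unique d : odd d -> only_lucas d -> uniqueness R d.
Proof.
move=> odd_d only f g Hf Hg nfg nomin.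
have nf : (2 * nterms f <= d + 3)%N.
  rewrite leqNgt; apply/negP => big_f; apply: nomin; exists (of_terms (sharp_terms R d)).
  by split; [exact: sharp_H2d | have := sharp_nterms R odd_d; lia].
have sf : sharp f d by split.
have sg : sharp g d by split=> //; rewrite -nfg.
have sf' := sharp_swap sf; have sg' := sharp_swap sg; rewrite /equivalent -/(swap g).
case: (sharp_orient sf only) => of_; case: (sharp_orient sg only) => og.
- by left; apply: sharp_eq of_ og.
- by right; apply: sharp_eq of_ og.
- by right; rewrite -(swap_swap f) (sharp_eq sf' sg of_ og).
- by left; rewrite -(swap_swap f) (sharp_eq sf' sg' of_ og) swap_swap.
Qed.

End Sharp.

Lemma only_lucas_1359 : [&& only_lucas 1, only_lucas 3, only_lucas 5 & only_lucas 9].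
Proof. by vm_compute. Qed.

Unset Implicit Arguments.

Theorem corollary2 (R : realType) :
  [/\ uniqueness R 1, uniqueness R 3, uniqueness R 5 & uniqueness R 9]
  /\ (forall d : nat, (2 <= d)%N -> ~~ odd d -> ~ uniqueness R d)
  /\ (uniqueness R 3 /\
      forall d : nat, (d = 3 %[mod 4])%N -> (7 <= d)%N -> ~ uniqueness R d)
  /\ (uniqueness R 1 /\ uniqueness R 5 /\
      forall d k : nat, (0 < k)%N ->
        d%:R = ((7 + 4 * Num.sqrt 3) ^+ (2 * k)
                + (7 - 4 * Num.sqrt 3) ^+ (2 * k)) / 2 :> R ->
        ~ uniqueness R d)
  /\ (forall d : nat, (1 < d)%N -> (d = 1 %[mod 6])%N -> ~ uniqueness R d).
Proof.
have /and4P[o1 o3 o5 o9] := only_lucas_1359.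
have u1 := @only_lucas_unique R 1 isT o1; have u3 := @only_lucas_unique R 3 isT o3.
have u5 := @only_lucas_unique R 5 isT o5; have u9 := @only_lucas_unique R 9 isT o9.
split; first by split.
split; first exact: not_unique_even.
split; first exact: (conj u3 (@not_unique_3_mod_4 R)).
split; last exact: not_unique_1_mod_6.
exact: (conj u1 (conj u5 (@not_unique_pell R))).
Qed.
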